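(* Let $T>0$, let $m\ge 1$, let $\alpha_0>\alpha_1>\cdots>\alpha_m\ge 0$ be real numbers, and let $n_i$ be the nonnegative integer with $n_i-1<\alpha_i\le n_i$ ($i=0,\dots,m$). Consider the equation $${}^cD_{0+}^{\alpha_0}y(t)=-\sum_{i=1}^m a_i(t)\,{}^cD_{0+}^{\alpha_i}y(t),\qquad 0<t<T.\tag{E}$$ Assume that $n_0>n_1$ and $a_i\in C[0,T]$ for $i=1,\dots,m$. With $H_j=\{i\in\{1,\dots,m\}:0\le\alpha_i\le j\}$, assume that $n_0\ge2$ and that there exists $j_0\in\{0,1,\dots,n_0-2\}$ such that $H_{j_0}=\emptyset$ and $H_{j_0+1}\ne\emptyset$; for $j\ge j_0+1$ put $h_j=\min H_j$. Then there exists a unique canonical fundamental system $y_j\in C^{\alpha_0,n_0-1}[0,T]$, $j=0,1,\dots,n_0-1$, of solutions of (E), and it is given by $$y_j(t)=\Phi_{j+1}(t),\qquad j=0,1,\dots,j_0,$$ $$y_j(t)=\Phi_{j+1}(t)+\sum_{k=0}^\infty(-1)^{k+1}I_{0+}^{\alpha_0}\Big[\sum_{i=1}^m a_i(t)I_{0+}^{\alpha_0-\alpha_i}\Big]^k\sum_{i=h_j}^m a_i(t)\Phi_{j+1-\alpha_i}(t),\qquad j=j_0+1,\dots,n_1-1,$$ $$y_j(t)=\Phi_{j+1}(t)+\sum_{k=0}^\infty(-1)^{k+1}I_{0+}^{\alpha_0}\Big[\sum_{i=1}^m a_i(t)I_{0+}^{\alpha_0-\alpha_i}\Big]^k\sum_{i=1}^m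 a_i(t)\Phi_{j+1-\alpha_i}(t),\qquad j=n_1,n_1+1,\dots,n_0-1.$$
   Context: All functions are real valued. Riemann–Liouville integral: $I_{0+}^\alpha f(t)=\frac1{\Gamma(\alpha)}\int_0^t(t-\tau)^{\alpha-1}f(\tau)\,d\tau$ for $\alpha>0$, and $I^0_{0+}f=f$. Riemann–Liouville derivative: for $n-1<\alpha\le n$, $D_{0+}^\alpha f(t)=\frac{d^n}{dt^n}I_{0+}^{n-\alpha}f(t)$ for $t>0$ (with $D^0_{0+}f=f$). Caputo derivative: for $n-1<\alpha\le n$, ${}^cD_{0+}^\alpha f(t)=D_{0+}^\alpha\big[f(t)-\sum_{k=0}^{n-1}\frac{f^{(k)}(0)}{k!}t^k\big]$; in particular ${}^cD^0_{0+}f=f$. $C^{\alpha_0,n_0-1}[0,T]$ is the space of functions $y\in C^{n_0-1}[0,T]$ with ${}^cD_{0+}^{\alpha_0}y\in C[0,T]$ (i.e. extending continuously to $[0,T]$). $\Phi_{\beta}(t)=t^{\beta-1}/\Gamma(\beta)$ for $\beta>0$; thus $\Phi_{j+1}(t)=t^j/j!$, and $\Phi_{j+1-\alpha_i}=D_{0+}^{\alpha_i}\Phi_{j+1}$ when $\alpha_i\le j$. The bracket $\big[\sum_i a_i(t)I_{0+}^{\alpha_0-\alpha_i}\big]^k$ is the $k$-th power (composition) of the operator $g\mapsto\sum_{i=1}^m a_i\cdot I_{0+}^{\alpha_0-\alpha_i}g$, the $0$-th power being the identity. The infinite series is the limit of its partial sums, for each $t\in[0,T]$. A range of indices $j$ whose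 lower bound exceeds its upper bound is empty. A canonical fundamental system of solutions of (E) is a system of functions $y_0,\dots,y_{n_0-1}$, each satisfying (E), with $D^ky_j(t)|_{t=+0}=1$ if $k=j$ and $=0$ if $k\ne j$, for $k,j=0,1,\dots,n_0-1$, where $D^k=d^k/dt^k$. *)

(* Defs.v *)
From mathcomp Require Import all_boot all_order all_algebra.
From mathcomp Require Import all_classical all_reals all_analysis.

Set Implicit Arguments.
Unset Strict Implicit.
Unset Printing Implicit Defensive.

Import Order.TTheory GRing.Theory Num.Theory.
Import numFieldNormedType.Exports.

Local Open Scope classical_set_scope.
Local Open Scope ring_scope.

(* Functions on [0, T] are represented by functions R -> R; everything below
   evaluates them on [0, T] only, and two of them are identified when they
   agree there. *)

Definition Gamma (R : realType) (b : R) : R :=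
  \int[lebesgue_measure]_(x in `]0, +oo[) (x `^ (b - 1) * expR (- x)).

(* Since 0 `^ 0 = 1, Phi 1 is the constant 1, also at t = 0. *)
Definition Phi (R : realType) (b t : R) : R := t `^ (b - 1) / Gamma b.

(* The integral is total (0 when it diverges); this plays no role for f
   continuous on [0, T], where it converges for all 0 <= t <= T. *)
Definition RLint (R : realType) (al : R) (f : R -> R) (t : R) : R :=
  if al == 0 then f t
  else (Gamma al)^-1 *
    \int[lebesgue_measure]_(x in `[0, t]) ((t - x) `^ (al - 1) * f x).

(* For 0 <= al, the n such that n - 1 < al <= n. *)
Definition ord_of (R : realType) (al : R) : nat := `|Num.ceil al|%N.

Definition RLderiv (R : realType) (al : R) (f : R -> R) : R -> R :=
  derive1n (ord_of al) (RLint ((ord_of al)%:R - al) f).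

(* The library derivative is total, so the existence on ]0, T[ of the
   derivatives occurring in RLderiv has to be stated separately. *)
Definition RLderivable (R : realType) (T al : R) (f : R -> R) : Prop :=
  forall (k : nat) (t : R), (k < ord_of al)%N -> 0 < t < T ->
    derivable (derive1n k (RLint ((ord_of al)%:R - al) f)) t 1.

(* Derivatives of functions on [0, T], one-sided at the endpoints. *)
Definition quot (R : realType) (f : R -> R) (t s : R) : R :=
  (f s - f t) / (s - t).

Definition derivable_seg (R : realType) (T : R) (f : R -> R) (t : R) : Prop :=
  cvg (quot f t s @[s --> within `[0, T] t^']).

Definition derive_seg (R : realType) (T : R) (f : R -> R) (t : R) : R :=
  lim (quot f t s @[s --> within `[0, T] t^']).

Definition deriven_seg (R : realType) (T : R) (k : nat) (f : R -> R) : R -> R :=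
  iter k (derive_seg T) f.

Definition Cn_seg (R : realType) (T : R) (k : nat) (f : R -> R) : Prop :=
  (forall (l : nat) (t : R), (l < k)%N -> 0 <= t <= T ->
     derivable_seg T (deriven_seg T l f) t) /\
  {within `[0, T], continuous (deriven_seg T k f)}.

Definition taylor_rem (R : realType) (T : R) (n : nat) (f : R -> R) (t : R) : R :=
  f t - \sum_(0 <= k < n) deriven_seg T k f 0 / k`!%:R * t ^+ k.

(* T only serves to give a meaning to the derivatives of f at 0. *)
Definition caputo (R : realType) (T al : R) (f : R -> R) : R -> R :=
  RLderiv al (taylor_rem T (ord_of al) f).

Definition caputo_derivable (R : realType) (T al : R) (f : R -> R) : Prop :=
  RLderivable T al (taylor_rem T (ord_of al) f).

(* The space C^{al,k}[0, T]. *)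
Definition Cfrac (R : realType) (T al : R) (k : nat) (y : R -> R) : Prop :=
  [/\ Cn_seg T k y,
      caputo_derivable T al y &
      exists g : R -> R, {within `[0, T], continuous g} /\
        forall t : R, 0 < t < T -> caputo T al y t = g t].

Definition solution (R : realType) (T : R) (m : nat) (al : nat -> R)
    (a : nat -> R -> R) (y : R -> R) : Prop :=
  (forall i : nat, (i <= m)%N -> caputo_derivable T (al i) y) /\
  (forall t : R, 0 < t < T ->
     caputo T (al 0%N) y t =
     - \sum_(1 <= i < m.+1) a i t * caputo T (al i) y t).

(* y 0, ..., y n0.-1 is the system; y j is irrelevant for n0 <= j. *)
Definition canonical_system (R : realType) (T : R) (m : nat) (al : nat -> R)
    (a : nat -> R -> R) (n0 : nat) (y : nat -> R -> R) : Prop :=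
  forall j : nat, (j < n0)%N ->
    solution T m al a (y j) /\
    forall k : nat, (k < n0)%N ->
      derive1n k (y j) t @[t --> 0^'+] --> ((k == j)%:R : R).

Definition Hset (R : realType) (m : nat) (al : nat -> R) (j : nat) : set nat :=
  [set i | (1 <= i <= m)%N /\ 0 <= al i <= j%:R].

Definition is_min (A : set nat) (h : nat) : Prop :=
  A h /\ forall i : nat, A i -> (h <= i)%N.

Definition opK (R : realType) (m : nat) (al : nat -> R) (a : nat -> R -> R)
    (g : R -> R) (t : R) : R :=
  \sum_(1 <= i < m.+1) a i t * RLint (al 0%N - al i) g t.

Definition source (R : realType) (m : nat) (al : nat -> R) (a : nat -> R -> R)
    (j h : nat) (t : R) : R :=
  \sum_(h <= i < m.+1) a i t * Phi (j.+1%:R - al i) t.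

Definition series_term (R : realType) (m : nat) (al : nat -> R)
    (a : nat -> R -> R) (j h : nat) (t : R) (k : nat) : R :=
  (-1) ^+ k.+1 *
    RLint (al 0%N) (iter k (opK m al a) (source m al a j h)) t.

Definition series_formula (R : realType) (T : R) (m : nat) (al : nat -> R)
    (a : nat -> R -> R) (j h : nat) (y : R -> R) : Prop :=
  forall t : R, 0 <= t <= T ->
    cvgn (series (series_term m al a j h t)) /\
    y t = Phi j.+1%:R t + limn (series (series_term m al a j h t)).

(* Main.v *)
(* Write I^b for the Riemann-Liouville integral of order b. If the derivatives
   of y at 0 are those of t^j/j!, then y = t^j/j! + I^(al 0) g on [0, T], where
   g is the Caputo derivative of order al 0; this rests on I^a I^b = I^(a + b)
   and on the injectivity of I^b. The Caputo derivative of order al i of such a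
   y is I^(al 0 - al i) g, plus Phi_(j+1-al i) when al i <= j, so (E) becomes
   the Volterra equation g = - K g - s with K = sum_i a_i I^(al 0 - al i). For
   the Bielecki norm sup |g t| e^(-l t), the operator I^b has norm at most l^-b,
   so K is a contraction for l large: g is unique and is the sum of the Neumann
   series of s, which I^(al 0) may integrate term by term.

   The semigroup law comes from the convolution identity
   k_a * k_b = B(a, b) k_(a+b) for k_a(x) = x^(a-1) on x > 0, and
   B(a, b) = Gamma(a) Gamma(b) / Gamma(a + b) follows by integrating this
   identity against e^(-x). *)

Require Import Defs.
From mathcomp Require Import all_boot all_order all_algebra.
From mathcomp Require Import all_classical all_reals all_analysis measurable_realfun.
From mathcomp Require Import ring lra.
Import Order.TTheory GRing.Theory Num.Theory.
Import numFieldNormedType.Exports.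
Local Open Scope classical_set_scope.
Local Open Scope ring_scope.

(** * Power kernels and the Gamma function *)

(** [caputo] constrains a solution only through derivatives inside []0, T[], and continuity up to 0
    is granted only to the derivatives of order below [n 0]. The [n 0]-fold derivative in the
    equation can therefore not be integrated back directly: the initial values of the intermediate
    derivatives of the fractional integral would be required. The way round is to write the Taylor
    remainder as an iterated integral of the top continuous derivative, which leaves one single
    derivative to integrate.

    The three index ranges of the formula are one case. The orders decrease, so the [i] with
    [al i <= j] form a tail of [1, ..., m]: empty for [j <= j0], starting at [h j] in the middle
    range, and everything once [n 1 <= j]. Emptiness of the set for [j0] also makes every order
    positive, which excludes Caputo derivatives of order 0.

    The data are continuous on [[0, T]] only, while the integrals are handled for functions
    continuous on the whole line; constant continuation outside the segment bridges the two. *)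

Section affine_change_of_variable.
Context {R : realType}.
Notation mu := (@lebesgue_measure R).

Lemma affine_measurable (c d : R) :
  measurable_fun [set: R] (fun x : R => c * x + d).
Proof. by apply: measurable_funD => //; exact: measurable_funM. Qed.

(** Lebesgue measure is determined by its values on half-open intervals, and [|c|] times the
    pushforward has the right ones. For [c < 0] the preimage of such an interval is half-open on the
    other side, hence the two cases. *)
Lemma lebesgue_measure_affine (c d : R) (A : set (measurableTypeR R)) : c != 0 ->
  measurable A ->
  mu A = (`|c|%:E * mu ((fun x => (c * x + d)%R) @^-1` A))%E.
Proof.
move=> c0 mA.
pose phi : measurableTypeR R -> measurableTypeR R := fun x => c * x + d.
have mphi : measurable_fun [set: measurableTypeR R] phi
  by exact: affine_measurable.
pose nu : {measure set (measurableTypeR R) -> \bar R} :=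
  mscale (NngNum (normr_ge0 c)) (pushforward mu phi).
rewrite (_ : (_ * _)%E = nu mphi A) //.
apply: lebesgue_measure_unique => //= _ [[a b]] _ <-.
rewrite /nu /mscale /= /pushforward lebesgue_measure_itv /=.
have [c_gt0|c_lt0|c_eq0] := ltgtP c 0; last by rewrite c_eq0 eqxx in c0.
  rewrite (_ : _ @^-1` _ = `[(b - d) / c, (a - d) / c[%classic); last first.
    apply/seteqP; split => x /=; rewrite /phi !in_itv /= => /andP[h1 h2];
      apply/andP; split.
    - by rewrite ler_ndivrMr //; lra.
    - by rewrite ltr_ndivlMr //; lra.
    - by move: h2; rewrite ltr_ndivlMr //; lra.
    - by move: h1; rewrite ler_ndivrMr //; lra.
  rewrite lebesgue_measure_itv /= !lte_fin ltr_nM2r ?invr_lt0 // ltrD2r.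
  case: ifPn => _; last by rewrite mule0.
  by rewrite -!EFinB -EFinM ltr0_norm //; congr EFin; field; rewrite lt_eqF.
rewrite (_ : _ @^-1` _ = `](a - d) / c, (b - d) / c]%classic); last first.
  apply/seteqP; split => x /=; rewrite /phi !in_itv /= => /andP[h1 h2];
    apply/andP; split.
  - by rewrite ltr_pdivrMr //; lra.
  - by rewrite ler_pdivlMr //; lra.
  - by move: h1; rewrite ltr_pdivrMr //; lra.
  - by move: h2; rewrite ler_pdivlMr //; lra.
rewrite lebesgue_measure_itv /= !lte_fin ltr_pM2r ?invr_gt0 // ltrD2r.
case: ifPn => _; last by rewrite mule0.
by rewrite -!EFinB -EFinM gtr0_norm //; congr EFin; field; rewrite gt_eqF.
Qed.

Lemma ge0_integral_affine (c d : R) (f : R -> \bar R) : c != 0 ->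
  measurable_fun [set: R] f -> (forall x, 0 <= f x)%E ->
  (\int[mu]_x f x = `|c|%:E * \int[mu]_x f (c * x + d)%R)%E.
Proof.
move=> c0 mf f0.
pose phi : measurableTypeR R -> measurableTypeR R := fun x => c * x + d.
have mphi : measurable_fun [set: measurableTypeR R] phi
  by exact: affine_measurable.
pose nu : {measure set (measurableTypeR R) -> \bar R} :=
  mscale (NngNum (normr_ge0 c)) (pushforward mu phi).
transitivity (\int[nu mphi]_x f x)%E.
  apply: eq_measure_integral => A mA _.
  exact: lebesgue_measure_affine.
rewrite ge0_integral_mscale //=; congr (_ * _)%E.
by rewrite ge0_integral_pushforward.
Qed.

End affine_change_of_variable.

Section gamma.
Context {R : realType}.
Notation mu := (@lebesgue_measure R).
Implicit Types a b x : R.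

(* Vanishing on x <= 0 turns integrals over [0, t] into convolutions on R. *)
Definition kernel a x : R := if 0 < x then x `^ (a - 1) else 0.

Lemma kernel_ge0 a x : 0 <= kernel a x.
Proof. by rewrite /kernel; case: ifP => // _; exact: powR_ge0. Qed.

Lemma kernel_gt0E a x : 0 < x -> kernel a x = x `^ (a - 1).
Proof. by rewrite /kernel => ->. Qed.

Lemma kernel_le0E a x : x <= 0 -> kernel a x = 0.
Proof. by rewrite /kernel ltNge => ->. Qed.

Lemma measurable_kernel a : measurable_fun [set: R] (kernel a).
Proof.
by apply: measurable_fun_ifT => //; exact: measurable_fun_ltr.
Qed.

Lemma measurable_expRN : measurable_fun [set: R] (fun x : R => expR (- x)).
Proof. by apply: measurableT_comp => //; exact: measurable_oppr. Qed.

(** For [a < 1] the integrand is singular at 0, so the primitive [x ^ a / a] is used on intervals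
    away from 0 that exhaust []0, 1]], and monotone convergence does the rest. *)
Lemma integral_powR_01 a : 0 < a ->
  (\int[mu]_(x in `]0%R, 1%R]) (x `^ (a - 1))%:E <= a^-1%:E)%E.
Proof.
move=> a0.
pose F i : set R := `[i.+1%:R^-1, 1]%classic.
have FE : `]0, 1]%classic = \bigcup_i F i.
  apply/seteqP; split => [x /=|x [i _] /=].
    rewrite in_itv /= => /andP[x0 x1].
    have [n _ xn] := near_infty_natSinv_lt (PosNum x0).
    exists n => //; rewrite /F /= in_itv /= x1 andbT.
    by apply: ltW; exact: (xn n (leqnn n)).
  rewrite /F /= !in_itv /= => /andP[x0 ->]; rewrite andbT.
  by apply: lt_le_trans x0.
rewrite FE.
have cv : (\int[mu]_(x in F i) (x `^ (a - 1))%:E @[i --> \oo] -->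
    \int[mu]_(x in \bigcup_i F i) (x `^ (a - 1))%:E)%E.
  apply: ge0_nondecreasing_set_cvg_integral.
  - move=> i j ij; apply/subsetPset => x; rewrite /F /= !in_itv /= => /andP[h ->].
    by rewrite andbT; apply: le_trans h; rewrite lef_pV2 ?posrE // ler_nat.
  - by move=> i; exact: measurable_itv.
  - move=> i; apply/measurable_EFinP; apply: measurable_funTS.
    exact: measurable_powR.
  - by move=> i x _; rewrite lee_fin powR_ge0.
rewrite -(cvg_lim _ cv) //.
apply: lime_le; first exact: (cvgP _ cv).
apply: nearW => i.
have i1 : i.+1%:R^-1 <= 1 :> R by rewrite invf_le1 // ler1n.
(* For [i = 0] the interval is the single point 1, while the fundamental theorem of calculus is
   applied on a nondegenerate interval. *)
have [i1'|i1'] := eqVneq (i.+1%:R^-1 : R) 1.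
  by rewrite /F i1' set_itv1 integral_set1 lee_fin invr_ge0 ltW.
have {i1' i1} i1 : i.+1%:R^-1 < 1 :> R by rewrite lt_neqAle i1'.
have ip : 0 < i.+1%:R^-1 :> R by rewrite invr_gt0.
have dF x : 0 < x -> is_derive x 1 (fun x => a^-1 * x `^ a) (x `^ (a - 1)).
  move=> x0; have xP : x \in `]0, +oo[ by rewrite in_itv /= x0.
  apply: is_derive_eq.
    apply: is_deriveZ; apply: DeriveDef; first exact: derivable_powR.
    by rewrite -derive1E powR_derive1.
  by rewrite /GRing.scale /= mulrA mulVf ?mul1r // gt_eqF.
have cF x : 0 < x -> {for x, continuous (fun x => a^-1 * x `^ a)}.
  move=> x0; apply: differentiable_continuous; apply/derivable1_diffP.
  exact: (@ex_derive _ _ _ _ _ _ _ (dF x x0)).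
rewrite (@continuous_FTC2 _ _ (fun x => a^-1 * x `^ a)) //.
- rewrite powR1 mulr1 -EFinB lee_fin lerBlDr lerDl mulr_ge0 ?invr_ge0 ?powR_ge0 //.
  exact: ltW.
- apply: derivable_within_continuous => x; rewrite in_itv /= => /andP[x0 _].
  by apply: derivable_powR; rewrite in_itv /= andbT; exact: lt_le_trans x0.
- split.
  + move=> x; rewrite in_itv /= => /andP[x0 _].
    exact: (@ex_derive _ _ _ _ _ _ _ (dF x (lt_trans ip x0))).
  + by apply: cvg_at_right_filter; exact: cF.
  + by apply: cvg_at_left_filter; exact: cF.
- move=> x; rewrite in_itv /= => /andP[x0 _].
  by rewrite derive1E; have [_ ->] := dF x (lt_trans ip x0).
Qed.

(** Extended values allow Tonelli and changes of variable before finiteness is known. *)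
Definition eGamma a : \bar R := \int[mu]_x (kernel a x * expR (- x))%:E.

Lemma GammaE a : Gamma a = fine (eGamma a).
Proof.
rewrite /Gamma /Rintegral integral_mkcond /eGamma; congr fine.
apply: eq_integral => x _; rewrite patchE /kernel.
rewrite mem_setE in_itv /= andbT.
by case: ifP => //; rewrite mul0r.
Qed.

Lemma measurable_gamma a : measurable_fun [set: R] (fun x => kernel a x * expR (- x)).
Proof.
by apply: measurable_funM; [exact: measurable_kernel|exact: measurable_expRN].
Qed.

Lemma gamma_ge0 a x : 0 <= kernel a x * expR (- x).
Proof. by rewrite mulr_ge0 ?kernel_ge0 ?expR_ge0. Qed.

(** Apply [ln y < y] to [y = x / (2 * a)] and multiply by [a]: this gives
    [a * ln x <= x / 2 + a * ln (2 * a)]. Half of the decay of [expR (- x)] remains available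
    afterwards. *)
Lemma powR_le_expR a x : 0 < a -> 1 <= x ->
  x `^ (a - 1) <= (2 * a) `^ a * expR (2^-1 * x).
Proof.
move=> a0 x1; have x0 : 0 < x by apply: lt_le_trans x1.
apply: (@le_trans _ _ (x `^ a)); first by apply: ler_powR => //; lra.
rewrite /powR !gt_eqF ?mulr_gt0 // -expRD ler_expR.
have h : 0 < x / (2 * a) by rewrite divr_gt0 ?mulr_gt0.
have := ln_sublinear h.
rewrite ln_div ?posrE ?mulr_gt0 // ltrBlDr => /ltW.
rewrite -(ler_pM2l a0) => h1; apply: (le_trans h1).
have -> : a * (x / (2 * a) + ln (2 * a)) = a * ln (2 * a) + 2^-1 * x; last exact: lexx.
by field; rewrite gt_eqF.
Qed.

Lemma eGamma_lty a : 0 < a -> (eGamma a < +oo)%E.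
Proof.
move=> a0.
pose g1 : R -> \bar R := (fun x : R => (x `^ (a - 1))%:E) \_ `]0, 1].
(* The factor 2 cancels the normalisation [2^-1] of the exponential density of rate [2^-1], whose
   total mass 1 bounds the tail beyond 1. *)
pose K := (2 * a) `^ a * 2.
pose g2 (x : R) : \bar R := (K%:E * (exponential_pdf 2^-1 x)%:E)%E.
have K0 : 0 <= K by rewrite mulr_ge0 // powR_ge0.
have mg1 : measurable_fun [set: R] g1.
  apply/(measurable_restrictT _ _).1 => //.
  by apply/measurable_EFinP; apply: measurable_funTS; exact: measurable_powR.
have mg2 : measurable_fun [set: R] g2.
  apply: measurable_funeM; apply/measurable_EFinP.
  exact: measurable_exponential_pdf.
have g10 x : (0 <= g1 x)%E.
  by rewrite /g1 patchE; case: ifP => // _; rewrite lee_fin powR_ge0.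
have g20 x : (0 <= g2 x)%E.
  by rewrite /g2 -EFinM lee_fin mulr_ge0 // exponential_pdf_ge0.
apply: (@le_lt_trans _ _ (\int[mu]_x (g1 x + g2 x))%E).
  apply: ge0_le_integral => //.
  - by move=> x _; rewrite lee_fin gamma_ge0.
  - by apply/measurable_EFinP; exact: measurable_gamma.
  - by apply: emeasurable_funD.
  move=> x _; have [x0|x0] := leP x 0.
    by rewrite kernel_le0E // mul0r adde_ge0.
  rewrite kernel_gt0E //; have [x1|x1] := leP x 1.
    apply: (@le_trans _ _ (g1 x)); last by rewrite leeDl.
    rewrite /g1 patchE mem_setE in_itv /= x0 x1 lee_fin ler_piMr ?powR_ge0 //.
    by rewrite expR_le1 oppr_le0 ltW.
  apply: (@le_trans _ _ (g2 x)); last by rewrite leeDr.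
  rewrite /g2 -EFinM lee_fin exponential_pdfE ?(ltW x0) //.
  apply: (@le_trans _ _ ((2 * a) `^ a * expR (2^-1 * x) * expR (- x))).
    by rewrite ler_wpM2r ?expR_ge0 // powR_le_expR // ltW.
  have KE y : K * (2^-1 * y) = (2 * a) `^ a * y by rewrite /K; field.
  rewrite KE -mulrA ler_wpM2l ?powR_ge0 //.
  by rewrite -expRD ler_expR; lra.
rewrite ge0_integralD // lte_add_pinfty //.
  rewrite /g1 -integral_mkcond.
  by apply: le_lt_trans (@integral_powR_01 a a0) _; exact: ltry.
rewrite /g2 ge0_integralZl //; last 2 first.
- by apply/measurable_EFinP; exact: measurable_exponential_pdf.
- by move=> x _; rewrite lee_fin exponential_pdf_ge0.
by rewrite integral_exponential_pdf ?mule1 ?ltry.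
Qed.

Lemma eGamma_gt0 a : 0 < a -> (0 < eGamma a)%E.
Proof.
(* On [[1, 2]], [x ^ (a - 1) >= x ^ (-1) >= 1 / 2] and [expR (- x) >= expR (- 2)]. *)
move=> a0; pose k := 2^-1 * expR (- 2) : R.
apply: (@lt_le_trans _ _ (\int[mu]_(x in `[1%R, 2%R]) k%:E)%E).
  rewrite integral_cst //= lebesgue_measure_itv /= lte_fin ltr1n -EFinB -EFinM.
  by rewrite lte_fin !mulr_gt0 ?expR_gt0 ?invr_gt0 //; lra.
apply: (@le_trans _ _ (\int[mu]_(x in `[1%R, 2%R]) (kernel a x * expR (- x))%:E)%E).
  apply: ge0_le_integral => //.
  - by move=> x _; rewrite lee_fin mulr_ge0 ?expR_ge0 ?invr_ge0.
  - by apply/measurable_EFinP; apply: measurable_funTS; exact: measurable_gamma.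
  move=> x; rewrite /= in_itv /= => /andP[x1 x2].
  have x0 : 0 < x by apply: lt_le_trans x1.
  rewrite lee_fin kernel_gt0E // ler_pM ?invr_ge0 ?expR_ge0 ?ler_expR ?lerN2 //.
  apply: (@le_trans _ _ (x `^ (- 1))); last by apply: ler_powR => //; lra.
  by rewrite powR_inv1 ?(ltW x0) // lef_pV2 ?posrE.
apply: ge0_subset_integral => //.
  by apply/measurable_EFinP; exact: measurable_gamma.
by move=> x _; rewrite lee_fin gamma_ge0.
Qed.

Lemma eGamma_fin a : 0 < a -> eGamma a = (Gamma a)%:E.
Proof.
move=> a0; rewrite GammaE fineK // ge0_fin_numE; first exact: eGamma_lty.
by apply: integral_ge0 => x _; rewrite lee_fin gamma_ge0.
Qed.

Lemma Gamma_gt0 a : 0 < a -> 0 < Gamma a.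
Proof. by move=> a0; rewrite -lte_fin -eGamma_fin // eGamma_gt0. Qed.

End gamma.

(** * Convolution of power kernels and the Beta function *)

Section convolution.
Context {R : realType}.
Notation mu := (@lebesgue_measure R).
Implicit Types a b x : R.

Lemma ge0_integralZl_EFinT (k : R) (f : R -> R) :
  measurable_fun [set: R] f -> (forall x, 0 <= f x) -> 0 <= k ->
  (\int[mu]_x (k * f x)%:E = k%:E * \int[mu]_x (f x)%:E)%E.
Proof.
move=> mf f0 k0; under eq_integral do rewrite EFinM.
rewrite ge0_integralZl //; first exact/measurable_EFinP.
by move=> x _; rewrite lee_fin.
Qed.

Lemma measurable_kernelB a t : measurable_fun [set: R] (fun x => kernel a (t - x)).
Proof. by apply: (measurableT_comp (measurable_kernel a)); exact: measurable_funB. Qed.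

Lemma measurable_kernelBM a b t :
  measurable_fun [set: R] (fun x => kernel a (t - x) * kernel b x).
Proof.
by apply: measurable_funM; [exact: measurable_kernelB|exact: measurable_kernel].
Qed.

Lemma kernelM_ge0 a b x y : 0 <= kernel a x * kernel b y.
Proof. by rewrite mulr_ge0 ?kernel_ge0. Qed.

Lemma measurable_subr : measurable_fun [set: R * R] (fun z : R * R => z.1 - z.2).
Proof. by apply: measurable_funB; [exact: measurable_fst|exact: measurable_snd]. Qed.

(** Tonelli puts the integral in [s] inside, where translation invariance removes the dependence on
    [x]. *)
Lemma ge0_integral_conv (f g : R -> R) :
  measurable_fun [set: R] f -> measurable_fun [set: R] g ->
  (forall x, 0 <= f x) -> (forall x, 0 <= g x) ->
  (\int[mu]_s \int[mu]_x (f (s - x) * g x)%:E =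
   (\int[mu]_x (f x)%:E) * (\int[mu]_x (g x)%:E))%E.
Proof.
move=> mf mg f0 g0.
have mF : measurable_fun [set: R * R]
    (fun z : R * R => (f (z.1 - z.2) * g z.2)%:E).
  apply/measurable_EFinP; apply: measurable_funM.
    by apply: measurableT_comp => //; exact: measurable_subr.
  by apply: measurableT_comp => //; exact: measurable_snd.
have If0 : (0 <= \int[mu]_x (f x)%:E)%E.
  by apply: integral_ge0 => x _; rewrite lee_fin.
rewrite (@fubini_tonelli _ _ _ _ R mu mu
    (fun z : R * R => (f (z.1 - z.2) * g z.2)%:E)) //=;
  last by move=> z; rewrite lee_fin mulr_ge0.
under eq_integral => x _.
  under eq_integral => s _ do rewrite EFinM.
  rewrite ge0_integralZr //; last 3 first.
  - apply/measurable_EFinP; apply: measurableT_comp => //.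
    by apply: measurable_funB.
  - by move=> s _; rewrite lee_fin.
  - by rewrite lee_fin.
  rewrite -[X in (X * _)%E]mul1e.
  have -> : (1 * \int[mu]_s (f (s - x))%:E = \int[mu]_s (f s)%:E)%E.
    rewrite (@ge0_integral_affine _ 1 (- x) (fun s => (f s)%:E)) //.
    - by rewrite normr1; under [in RHS]eq_integral do rewrite mul1r.
    - exact/measurable_EFinP.
  over.
rewrite ge0_integralZl //; first exact/measurable_EFinP.
by move=> x _; rewrite lee_fin.
Qed.

(** The Beta integral, seen as the convolution of the two kernels at the point 1; the kernels
    themselves restrict it to []0, 1[]. *)
Definition eBeta a b : \bar R := \int[mu]_x (kernel a (1 - x) * kernel b x)%:E.

Lemma kernelM a s x : 0 < s -> kernel a (s * x) = s `^ (a - 1) * kernel a x.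
Proof.
move=> s0; rewrite /kernel pmulr_rgt0 //; case: ifP => x0; last by rewrite mulr0.
by rewrite powRM // ltW.
Qed.

(** For [s > 0] the substitution [x = s u] extracts [s * s ^ (a - 1) * s ^ (b - 1)]. For [s <= 0]
    one of the two factors vanishes at every [x]. *)
Lemma kernel_conv a b s :
  (\int[mu]_x (kernel a (s - x) * kernel b x)%:E =
   (kernel (a + b) s)%:E * eBeta a b)%E.
Proof.
have [s0|s0] := leP s 0.
  rewrite kernel_le0E // mul0e integral0_eq // => x _.
  have [x0|x0] := leP x 0; first by rewrite [kernel b _]kernel_le0E // mulr0.
  by rewrite kernel_le0E ?mul0r // subr_le0 (le_trans s0) // ltW.
rewrite (@ge0_integral_affine _ s 0 _ (lt0r_neq0 s0)); last 2 first.
- by apply/measurable_EFinP; exact: measurable_kernelBM.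
- by move=> x; rewrite lee_fin kernelM_ge0.
rewrite (gtr0_norm s0).
under eq_integral => x _.
  rewrite addr0 -{1}(mulr1 s) -mulrBr !kernelM // mulrACA; over.
rewrite (ge0_integralZl_EFinT _ _ (measurable_kernelBM a b 1)
  (fun x => kernelM_ge0 _ _ _ _)); last by rewrite mulr_ge0 ?powR_ge0.
rewrite muleA -EFinM kernel_gt0E //; congr (_%:E * _)%E.
rewrite -[X in X * _](powRr1 (ltW s0)) -!powRD ?(lt0r_neq0 s0) ?implybT //.
by congr (_ `^ _); ring.
Qed.

(* Integrate e^(-s) times the convolution of the two kernels in two ways. *)
Lemma eGamma_eBeta a b : (eGamma a * eGamma b = eGamma (a + b) * eBeta a b)%E.
Proof.
rewrite -ge0_integral_conv; try exact: measurable_gamma; try exact: gamma_ge0.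
have eB0 : (0 <= eBeta a b)%E.
  by apply: integral_ge0 => x _; rewrite lee_fin mulr_ge0 ?kernel_ge0.
rewrite /eGamma -ge0_integralZr //; last 2 first.
- by apply/measurable_EFinP; exact: measurable_gamma.
- by move=> x _; rewrite lee_fin gamma_ge0.
apply: eq_integral => s _.
transitivity (\int[mu]_x (expR (- s) * (kernel a (s - x) * kernel b x))%:E)%E.
  apply: eq_integral => x _; congr EFin.
  rewrite mulrACA -expRD mulrC; congr (expR _ * _); ring.
rewrite (ge0_integralZl_EFinT _ _ (measurable_kernelBM a b s)
  (fun x => kernelM_ge0 _ _ _ _) (expR_ge0 _)).
rewrite kernel_conv muleA -EFinM; congr (_%:E * _)%E; exact: mulrC.
Qed.

Lemma eBetaE a b : 0 < a -> 0 < b ->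
  eBeta a b = (Gamma a * Gamma b / Gamma (a + b))%:E.
Proof.
move=> a0 b0; have := eGamma_eBeta a b.
rewrite !eGamma_fin ?addr_gt0 // -EFinM => h.
have g0 : (Gamma (a + b) != 0 :> R) by rewrite gt_eqF // Gamma_gt0 // addr_gt0.
rewrite mulrC EFinM h muleA -EFinM mulVf // mul1e //.
Qed.

(** Associativity of convolution: after exchanging the integrals and translating [x] by [u], the
    inner one is [kernel_conv] at [t - u]. *)
Lemma kernel_semigroup a b t (F : R -> R) : measurable_fun [set: R] F ->
  (forall x, 0 <= F x) ->
  (\int[mu]_x ((kernel a (t - x))%:E * \int[mu]_u (kernel b (x - u) * F u)%:E) =
   eBeta a b * \int[mu]_u (kernel (a + b) (t - u) * F u)%:E)%E.
Proof.
move=> mF F0.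
pose h (z : R * R) := (kernel a (t - z.1) * (kernel b (z.1 - z.2) * F z.2))%:E.
have mh : measurable_fun [set: R * R] h.
  apply/measurable_EFinP; apply: measurable_funM.
    apply: (measurableT_comp (measurable_kernelB a t)); exact: measurable_fst.
  apply: measurable_funM; last exact: (measurableT_comp mF).
  by apply: measurableT_comp; [exact: measurable_kernel|exact: measurable_subr].
have h0 z : (0 <= h z)%E by rewrite lee_fin !mulr_ge0 ?kernel_ge0.
transitivity (\int[mu]_x \int[mu]_u h (x, u))%E.
  apply: eq_integral => x _; rewrite -ge0_integralZl //.
  - apply/measurable_EFinP; apply: measurable_funM => //.
    exact: measurable_kernelB.
  - by move=> u _; rewrite lee_fin mulr_ge0 ?kernel_ge0.
  - by rewrite lee_fin kernel_ge0.
rewrite fubini_tonelli //.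
have eB0 : (0 <= eBeta a b)%E.
  by apply: integral_ge0 => x _; rewrite lee_fin mulr_ge0 ?kernel_ge0.
rewrite -ge0_integralZl //; last 2 first.
- apply/measurable_EFinP; apply: measurable_funM => //; exact: measurable_kernelB.
- by move=> u _; rewrite lee_fin mulr_ge0 ?kernel_ge0.
apply: eq_integral => u _.
rewrite (@ge0_integral_affine _ 1 u) ?oner_eq0 //; last first.
  by apply: (measurableT_comp mh); exact: measurable_pair2.
rewrite normr1 mul1e.
transitivity (\int[mu]_x (F u * (kernel a ((t - u) - x) * kernel b x))%:E)%E.
  apply: eq_integral => x _; rewrite /h /= mul1r mulrA mulrC.
  by congr (_ * (kernel _ _ * kernel _ _))%:E; ring.
rewrite (ge0_integralZl_EFinT _ _ (measurable_kernelBM a b (t - u))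
  (fun x => kernelM_ge0 _ _ _ _) (F0 u)).
rewrite kernel_conv muleA -EFinM muleC; congr (_ * _%:E)%E; exact: mulrC.
Qed.

End convolution.

(** * Riemann-Liouville integrals of continuous functions *)

Section riemann_liouville.
Context {R : realType}.
Notation mu := (@lebesgue_measure R).
Implicit Types (a b t x : R) (F G : R -> R).

Lemma continuous_locally_bounded F c : continuous F ->
  exists2 M, 0 <= M & forall x, `|x| <= c -> `|F x| <= M.
Proof.
move=> cF; have [c0|c0] := ltP c 0.
  by exists 0 => // x xc; have := lt_le_trans c0 (le_trans (normr_ge0 x) xc);
    rewrite ltxx.
have cc : - c <= c by rewrite (le_trans _ c0) // oppr_le0.
have [|z _ zmax] := @EVT_max _ (fun x => `|F x|) _ _ cc.
  by apply: continuous_subspaceT => x; apply: cvg_norm; exact: cF.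
exists `|F z| => // x; rewrite ler_norml => xc; apply: zmax.
by rewrite in_itv.
Qed.

Lemma kernel1E x : kernel 1 x = if 0 < x then 1 else 0.
Proof. by rewrite /kernel subrr; case: ifP => //; rewrite powRr0. Qed.

Lemma integrable_kernelBM a b t : 0 < a -> 0 < b ->
  mu.-integrable setT (fun x => (kernel a (t - x) * kernel b x)%:E).
Proof.
move=> a0 b0; apply/integrableP; split.
  by apply/measurable_EFinP; exact: measurable_kernelBM.
under eq_integral => x _ do rewrite gee0_abs ?lee_fin ?kernelM_ge0 //.
by rewrite kernel_conv eBetaE // -EFinM ltry.
Qed.

(** The two kernels confine [x] to []0, t[], where [F] is bounded, so the Beta integrand
    dominates. *)
Lemma integrable_kernel_fun a t F : 0 < a -> continuous F ->
  mu.-integrable setT (fun x => (kernel a (t - x) * (kernel 1 x * F x))%:E).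
Proof.
move=> a0 cF; have [M M0 hM] := continuous_locally_bounded F `|t| cF.
have gi : mu.-integrable setT
    (fun x => (M%:E * (kernel a (t - x) * kernel 1 x)%:E)%E).
  by apply: integrableZl => //; exact: integrable_kernelBM.
apply: (le_integrable measurableT _ _ gi).
- apply/measurable_EFinP; apply: measurable_funM; first exact: measurable_kernelB.
  by apply: measurable_funM; [exact: measurable_kernel|exact: continuous_measurable_fun].
- move=> x _; rewrite -EFinM lee_fin [leRHS]ger0_norm; last first.
    by rewrite mulr_ge0 // kernelM_ge0.
  rewrite mulrA normrM (ger0_norm (kernelM_ge0 _ _ _ _)) mulrC.
  have [x0|x0] := leP x 0; first by rewrite [kernel 1 x]kernel_le0E // !mulr0.
  have [tx|tx] := leP (t - x) 0; first by rewrite kernel_le0E // !mul0r !mulr0.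
  rewrite ler_wpM2r ?kernelM_ge0 // hM // (ger0_norm (ltW x0)).
  by rewrite ger0_norm; lra.
Qed.

(** The convolution form of the integral, [kernel 1] being the indicator of the positive half-line.
    The endpoints 0 and [t], where the kernels may disagree with the original integrand, form a null
    set. *)
Lemma RLintE a t F : 0 < a -> continuous F ->
  RLint a F t =
  (Gamma a)^-1 * \int[mu]_x (kernel a (t - x) * (kernel 1 x * F x)).
Proof.
move=> a0 cF; rewrite /RLint gt_eqF //; congr (_ * _).
have mf D : measurable D ->
    measurable_fun D (fun x => ((t - x) `^ (a - 1) * F x)%:E).
  move=> mD; apply/measurable_EFinP; apply: measurable_funTS; apply: measurable_funM.
    by apply: (measurableT_comp (@measurable_powR R (a - 1))); exact: measurable_funB.
  exact: continuous_measurable_fun.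
transitivity (\int[mu]_(x in `]0, t[) ((t - x) `^ (a - 1) * F x)).
  rewrite /Rintegral; congr fine.
  rewrite -integral_itv_obnd_cbnd; last exact: mf.
  by rewrite -integral_itv_bndo_bndc //; exact: mf.
rewrite Rintegral_mkcond; apply: eq_Rintegral => x _.
rewrite patchE mem_setE in_itv /= kernel1E /kernel subr_gt0.
case: ifP => [/andP[-> ->]|/negP/negP]; first by rewrite mul1r.
by rewrite negb_and => /orP[] /negbTE ->; rewrite ?mul0r // mulr0.
Qed.

Lemma eq_RLint a t F G : 0 <= t -> (forall x, 0 <= x <= t -> F x = G x) ->
  RLint a F t = RLint a G t.
Proof.
move=> t0 FG; rewrite /RLint; case: ifP => _; first by rewrite FG // t0 lexx.
by congr (_ * _); apply: eq_Rintegral => x; rewrite inE /= in_itv /= => /FG ->.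
Qed.

Lemma RLint0 F t : RLint 0 F t = F t.
Proof. by rewrite /RLint eqxx. Qed.

Lemma RLint_le0E a t F : 0 < a -> continuous F -> t <= 0 -> RLint a F t = 0.
Proof.
move=> a0 cF t0; rewrite RLintE // /Rintegral integral0_eq ?mulr0 // => x _.
have [x0|x0] := leP x 0; first by rewrite [kernel 1 x]kernel_le0E // mul0r mulr0.
by rewrite kernel_le0E ?mul0r // subr_le0 (le_trans t0) // ltW.
Qed.

Lemma RLintD a t F G : 0 <= a -> continuous F -> continuous G ->
  RLint a (fun x => F x + G x) t = RLint a F t + RLint a G t.
Proof.
rewrite le_eqVlt => /predU1P[<-|a0] cF cG; first by rewrite !RLint0.
have cFG : continuous (fun x => F x + G x).
  by move=> x; apply: cvgD; [exact: cF|exact: cG].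
rewrite !RLintE // -mulrDr -RintegralD //; try exact: integrable_kernel_fun.
by congr (_ * _); apply: eq_Rintegral => x _; rewrite !mulrDr.
Qed.

Lemma RLintZ a t c F : 0 <= a -> continuous F ->
  RLint a (fun x => c * F x) t = c * RLint a F t.
Proof.
rewrite le_eqVlt => /predU1P[<-|a0] cF; first by rewrite !RLint0.
have cG : continuous (fun x => c * F x).
  by move=> x; apply: cvgM; [exact: cvg_cst|exact: cF].
rewrite !RLintE // [RHS]mulrCA -[in RHS]RintegralZl //; last exact: integrable_kernel_fun.
by congr (_ * _); apply: eq_Rintegral => x _; ring.
Qed.

Lemma RLintB a t F G : 0 <= a -> continuous F -> continuous G ->
  RLint a (fun x => F x - G x) t = RLint a F t - RLint a G t.
Proof.
move=> a0 cF cG; have cN : continuous (fun x => -1 * G x).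
  by move=> x; apply: cvgM; [exact: cvg_cst|exact: cG].
rewrite -[in RHS]mulN1r -RLintZ // -RLintD //.
by congr RLint; apply/funext => x; rewrite mulN1r.
Qed.

(** The substitution [x = t - u / l] turns this into the Gamma integral; it is the source of the
    factor [l ^ (- a)] that makes the operator contract. *)
Lemma integral_kernel_expR a t l : 0 < a -> 0 < l ->
  (\int[mu]_x (kernel a (t - x) * expR (l * x))%:E =
   (l `^ (- a) * expR (l * t) * Gamma a)%:E)%E.
Proof.
move=> a0 l0; have l1 : 0 < l^-1 by rewrite invr_gt0.
rewrite EFinM -eGamma_fin // (@ge0_integral_affine _ (- l^-1) t); last 3 first.
- by rewrite oppr_eq0 gt_eqF.
- apply/measurable_EFinP; apply: measurable_funM; first exact: measurable_kernelB.
  by apply: (measurableT_comp (@measurable_expR R)); exact: measurable_funM.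
- by move=> x; rewrite lee_fin mulr_ge0 ?kernel_ge0 ?expR_ge0.
rewrite normrN (gtr0_norm l1).
transitivity (l^-1%:E * \int[mu]_x (l^-1 `^ (a - 1) * expR (l * t) *
    (kernel a x * expR (- x)))%:E)%E.
  congr (_ * _)%E; apply: eq_integral => x _; congr EFin.
  rewrite (_ : t - _ = l^-1 * x); last by ring.
  rewrite (_ : l * _ = l * t + - x); last by field; rewrite gt_eqF.
  by rewrite kernelM // expRD mulrACA.
rewrite (ge0_integralZl_EFinT _ _ (measurable_gamma a) (gamma_ge0 a)); last first.
  by rewrite mulr_ge0 ?powR_ge0 ?expR_ge0.
rewrite muleA -EFinM mulrA; congr ((_ * _)%:E * _)%E.
rewrite mulr_powRB1 ?(ltW l1) // -powR_inv1 ?(ltW l0) // -powRrM.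
by rewrite mulN1r.
Qed.

(** The hypothesis bounds the integrand on []0, t[], outside of which it vanishes. Integrating the
    bound over the whole line instead of []0, t[] only enlarges it and makes it explicit. *)
Lemma RLint_expR_bound a t F A l : 0 <= a -> 0 <= t -> 0 < l -> continuous F ->
  0 <= A -> (forall x, 0 <= x <= t -> `|F x| <= A * expR (l * x)) ->
  `|RLint a F t| <= A * l `^ (- a) * expR (l * t).
Proof.
rewrite le_eqVlt => /predU1P[<-|a0] t0 l0 cF A0 FA.
  by rewrite RLint0 oppr0 powRr0 mulr1 FA // t0 lexx.
have G0 := Gamma_gt0 a a0.
rewrite RLintE // normrM gtr0_norm ?invr_gt0 // mulrC ler_pdivrMr //.
have iF := integrable_kernel_fun a t F a0 cF.
rewrite -lee_fin EFin_normr_Rintegral //.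
apply: (le_trans (le_abse_integral _ _ _)) => //.
  by case/integrableP: iF.
have -> : ((A * l `^ (- a) * expR (l * t) * Gamma a)%:E =
   \int[mu]_x (A * (kernel a (t - x) * expR (l * x)))%:E)%E.
  rewrite ge0_integralZl_EFinT //.
  - by rewrite integral_kernel_expR // -EFinM !mulrA.
  - apply: measurable_funM; first exact: measurable_kernelB.
    by apply: (measurableT_comp (@measurable_expR R)); exact: measurable_funM.
  - by move=> x; rewrite mulr_ge0 ?kernel_ge0 ?expR_ge0.
apply: ge0_le_integral => //.
- by apply: measurableT_comp => //; case/integrableP: iF.
- apply/measurable_EFinP; apply: measurable_funM => //.
  apply: measurable_funM; first exact: measurable_kernelB.
  by apply: (measurableT_comp (@measurable_expR R)); exact: measurable_funM.
move=> x _; rewrite lee_fin normrM (ger0_norm (kernel_ge0 _ _)) mulrCA.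
have [tx|tx] := leP (t - x) 0; first by rewrite kernel_le0E // !mul0r.
rewrite ler_wpM2l ?kernel_ge0 // normrM (ger0_norm (kernel_ge0 _ _)) kernel1E.
case: ifP => x0; last by rewrite mul0r mulr_ge0 ?expR_ge0.
by rewrite mul1r FA // (ltW x0) -subr_ge0 ltW.
Qed.

Lemma Gamma1 : Gamma 1 = 1 :> R.
Proof.
apply: EFin_inj; rewrite -eGamma_fin // /eGamma.
rewrite -(@integral_exponential_pdf R 1) // integral_mkcond.
rewrite [RHS](_ : _ = \int[mu]_(x in `]0%R, +oo[) (expR (- x))%:E)%E.
  rewrite [RHS]integral_mkcond; apply: eq_integral => x _.
  rewrite !patchE in_setT mem_setE in_itv /= andbT kernel1E.
  by case: ifP; rewrite ?mul0r ?mul1r.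
rewrite integral_itv_obnd_cbnd; last first.
  by apply/measurable_EFinP; apply: measurable_funTS; exact: measurable_expRN.
rewrite [RHS]integral_mkcond; apply: eq_integral => x _.
rewrite patchE mem_setE in_itv /= andbT.
case: ifP => x0; first by rewrite exponential_pdfE // mul1r mulN1r.
by rewrite lt0_exponential_pdf // ltNge x0.
Qed.

(** This is [kernel_conv] with [b = 1]. Writing the functions [Phi] as integrals of the constant 1
    subjects monomials and their fractional derivatives to the semigroup law as well. *)
Lemma RLint_cst1 a t : 0 <= a -> 0 <= t -> RLint a (fun=> 1) t = Phi (a + 1) t.
Proof.
rewrite /Phi addrK le_eqVlt => /predU1P[<-|a0] t0.
  by rewrite RLint0 add0r powRr0 Gamma1 divr1.
rewrite RLintE //; last by move=> x; exact: cvg_cst.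
rewrite /Rintegral; under eq_integral do rewrite mulr1.
rewrite kernel_conv eBetaE // Gamma1 mulr1 -EFinM /=.
have -> : kernel (a + 1) t = t `^ a.
  move: t0; rewrite le_eqVlt => /predU1P[<-|t0].
    by rewrite kernel_le0E // powR0 // gt_eqF.
  by rewrite kernel_gt0E // addrK.
move: (Gamma_gt0 a a0) (Gamma_gt0 (a + 1) (addr_gt0 a0 ltr01)).
by move: (Gamma a) (Gamma (a + 1)) => x y x0 y0; field; rewrite !gt_eqF.
Qed.

Lemma EFin_RLint a t F : 0 < a -> continuous F ->
  ((RLint a F t)%:E =
   (Gamma a)^-1%:E * \int[mu]_x (kernel a (t - x) * (kernel 1 x * F x))%:E)%E.
Proof.
move=> a0 cF; rewrite RLintE // EFinM /Rintegral fineK //.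
exact: integrable_fin_num (integrable_kernel_fun a t F a0 cF).
Qed.

(** The constant left over from [kernel_semigroup] is [B(a, b) / (Gamma a * Gamma b)], that is,
    [1 / Gamma (a + b)]. *)
Lemma RLint_semigroup_ge0 a b t F : 0 < a -> 0 < b ->
  continuous F -> continuous (RLint b F) -> (forall x, 0 <= F x) ->
  RLint a (RLint b F) t = RLint (a + b) F t.
Proof.
move=> a0 b0 cF cIF F0; have ab0 := addr_gt0 a0 b0.
have mF : measurable_fun [set: R] (fun x => kernel 1 x * F x).
  by apply: measurable_funM; [exact: measurable_kernel|exact: continuous_measurable_fun].
have F10 x : 0 <= kernel 1 x * F x by rewrite mulr_ge0 ?kernel_ge0.
have mkF c s : measurable_fun [set: R] (fun x => kernel c (s - x) * (kernel 1 x * F x)).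
  by apply: measurable_funM => //; exact: measurable_kernelB.
have kF0 c s x : 0 <= kernel c (s - x) * (kernel 1 x * F x).
  by rewrite mulr_ge0 ?kernel_ge0.
have Gb0 : 0 <= (Gamma b)^-1 by rewrite invr_ge0 (ltW (Gamma_gt0 _ b0)).
apply: EFin_inj.
rewrite (EFin_RLint _ t _ a0 cIF) (EFin_RLint _ t _ ab0 cF).
transitivity ((Gamma a)^-1%:E * \int[mu]_x ((kernel a (t - x))%:E *
    \int[mu]_u (kernel b (x - u) * ((Gamma b)^-1 * (kernel 1 u * F u)))%:E))%E.
  congr (_ * _)%E; apply: eq_integral => x _; rewrite EFinM; congr (_ * _)%E.
  under eq_integral => u _ do rewrite mulrCA.
  rewrite (ge0_integralZl_EFinT _ _ (mkF b x) (kF0 b x)) // -EFin_RLint //.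
  (* The outer truncation changes nothing, since [RLint b F] vanishes on [x <= 0]. *)
  rewrite kernel1E; case: ifPn; rewrite ?mul1r // -leNgt => x0.
  by rewrite RLint_le0E // mul0r.
rewrite kernel_semigroup; last 2 first.
- by apply: measurable_funM.
- by move=> x; rewrite mulr_ge0.
under eq_integral => u _ do rewrite mulrCA.
rewrite (ge0_integralZl_EFinT _ _ (mkF (a + b) t) (kF0 (a + b) t)) // eBetaE //.
rewrite !muleA -!EFinM; congr (_%:E * _)%E.
move: (Gamma_gt0 _ a0) (Gamma_gt0 _ b0) (Gamma_gt0 _ ab0).
move: (Gamma a) (Gamma b) (Gamma (a + b)) => x y z x0 y0 z0.
by field; rewrite !gt_eqF.
Qed.

(* Substituting x = t u in RLint a F t gives a weight that does not depend on t,
   whence the continuity of RLint a F. *)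
Definition scaled_integral a F t : R :=
  \int[mu]_u (kernel a (1 - u) * kernel 1 u * F (t * u)).

Lemma scaled_integrand_le a F N M t u : (forall x, `|x| <= N -> `|F x| <= M) ->
  `|t| <= N ->
  `|kernel a (1 - u) * kernel 1 u * F (t * u)| <= M * (kernel a (1 - u) * kernel 1 u).
Proof.
move=> hM tN; rewrite normrM (ger0_norm (kernelM_ge0 _ _ _ _)) mulrC.
have [x0|x0] := leP u 0; first by rewrite [kernel 1 u]kernel_le0E // !mulr0.
have [tx|tx] := leP (1 - u) 0; first by rewrite kernel_le0E // !mul0r !mulr0.
rewrite ler_wpM2r ?kernelM_ge0 // hM // normrM.
rewrite (le_trans _ tN) // ler_piMr // ger0_norm; lra.
Qed.

Lemma measurable_scaled_integrand a F t : continuous F ->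
  measurable_fun [set: R] (fun u => kernel a (1 - u) * kernel 1 u * F (t * u)).
Proof.
move=> cF; apply: measurable_funM; first exact: measurable_kernelBM.
apply: (measurableT_comp (continuous_measurable_fun cF)); exact: measurable_funM.
Qed.

Lemma integrable_scaled_bound a M : 0 < a ->
  mu.-integrable setT (EFin \o (fun u => M * (kernel a (1 - u) * kernel 1 u))).
Proof.
move=> a0.
rewrite (_ : _ \o _ = fun u => (M%:E * (kernel a (1 - u) * kernel 1 u)%:E)%E) //.
by apply: integrableZl => //; exact: integrable_kernelBM.
Qed.

Lemma integrable_scaled_integrand a F t : 0 < a -> continuous F ->
  mu.-integrable setT (EFin \o (fun u => kernel a (1 - u) * kernel 1 u * F (t * u))).
Proof.
move=> a0 cF; have [M M0 hM] := continuous_locally_bounded F `|t| cF.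
apply: (le_integrable measurableT _ _ (integrable_scaled_bound a M a0)).
  by apply/measurable_EFinP; exact: measurable_scaled_integrand.
move=> u _; rewrite /= lee_fin [leRHS]ger0_norm ?mulr_ge0 ?kernel_ge0 //.
exact: scaled_integrand_le hM _.
Qed.

Lemma continuous_scaled_integral a F : 0 < a -> continuous F ->
  continuous (scaled_integral a F).
Proof.
move=> a0 cF t0.
(* Any bound above [|t0|] would do: dominated convergence needs one majorant on an open interval
   around [t0]. *)
pose N := `|t0| + 1.
have [M M0 hM] := continuous_locally_bounded F N cF.
have tN0 : t0 \in `]- N, N[%classic.
  by rewrite inE /= in_itv /= -ltr_norml /N ltrDl.
apply: (@continuity_under_integral R _ _ mu
  (fun t u => kernel a (1 - u) * kernel 1 u * F (t * u)) setT measurableT (- N) N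
  _ _ (fun u => M * (kernel a (1 - u) * kernel 1 u)) _ _ t0 tN0).
- by move=> t tN; exact: integrable_scaled_integrand.
- apply: aeW => u _ t _; apply: cvgM; first exact: cvg_cst.
  apply: (@continuous_comp _ _ _ (fun t => t * u) F); last exact: cF.
  by apply: cvgMr_tmp; exact: cvg_id.
- exact: integrable_scaled_bound.
- move=> t tN; apply: aeW => u _; apply: (scaled_integrand_le _ _ _ _ _ _ hM).
  by move: tN; rewrite /= in_itv /= -ltr_norml => /ltW.
Qed.

Lemma RLint_scaled_ge0 a t F : 0 < a -> 0 < t -> continuous F ->
  (forall x, 0 <= F x) ->
  RLint a F t = t `^ a / Gamma a * scaled_integral a F t.
Proof.
move=> a0 t0 cF F0.
have mF : measurable_fun [set: R] (fun x => kernel a (t - x) * (kernel 1 x * F x)).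
  apply: measurable_funM; first exact: measurable_kernelB.
  by apply: measurable_funM; [exact: measurable_kernel|exact: continuous_measurable_fun].
rewrite RLintE // (mulrC (t `^ a)) -mulrA; congr (_ * _).
rewrite /Rintegral (@ge0_integral_affine _ t 0 _ (lt0r_neq0 t0)); last 2 first.
- exact/measurable_EFinP.
- by move=> x; rewrite lee_fin mulrA mulr_ge0 ?kernelM_ge0.
rewrite (gtr0_norm t0).
transitivity (fine (t%:E * \int[mu]_u
   (t `^ (a - 1) * (kernel a (1 - u) * kernel 1 u * F (t * u)))%:E)%E).
  congr (fine (_ * _)%E); apply: eq_integral => u _; congr EFin.
  rewrite addr0 -{1}(mulr1 t) -mulrBr !kernelM // subrr powRr0 mul1r.
  by rewrite !mulrA.
rewrite (ge0_integralZl_EFinT _ _ (measurable_scaled_integrand a F t cF)); last 2 first.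
- by move=> x; rewrite mulr_ge0 ?kernelM_ge0.
- exact: powR_ge0.
rewrite muleA -EFinM mulr_powRB1 ?(ltW t0) // fineM //.
exact: integrable_fin_num (integrable_scaled_integrand a F t a0 cF).
Qed.

Lemma continuous_max0 (f : R -> R) : continuous f ->
  continuous (fun x => Num.max (f x) 0).
Proof.
by move=> cf x; apply: (@continuous_max R R f (cst 0)); [exact: cf|exact: cst_continuous].
Qed.

(** Replacing [t] by its positive part in the prefactor of the scaled integral gives one formula for
    [RLint] on both sides of 0, as [RLint] vanishes for [t <= 0]. *)
Lemma continuous_powR_max a : 0 < a -> continuous (fun t => (Num.max t 0) `^ a).
Proof.
move=> a0 t; have [t0|t0] := leP t 0.
  apply/cvgrPdist_lt => e e0.
  have xe : \forall x \near t, x < e `^ a^-1.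
    by apply: lt_nbhsl; apply: le_lt_trans t0 _; rewrite powR_gt0.
  apply: filterS xe => x xe.
  rewrite (max_idPr t0) powR0 ?gt_eqF // sub0r normrN ger0_norm ?powR_ge0 //.
  have -> : e = (e `^ a^-1) `^ a by rewrite -powRrM mulVf ?gt_eqF // powRr1 // ltW.
  apply: gt0_ltr_powR => //; rewrite ?nnegrE ?powR_ge0 // ?le_max ?lexx ?orbT //.
  by rewrite gt_max xe powR_gt0.
apply: (@continuous_comp _ _ _ (fun t => Num.max t 0) (fun t => t `^ a)).
  by apply: (@continuous_max0 id) => y; exact: cvg_id.
apply: differentiable_continuous; apply/derivable1_diffP; apply: derivable_powR.
by rewrite in_itv /= andbT lt_max t0.
Qed.

Lemma continuous_RLint_ge0 a F : 0 < a -> continuous F -> (forall x, 0 <= F x) ->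
  continuous (RLint a F).
Proof.
move=> a0 cF F0.
have -> : RLint a F =
    (fun t => (Num.max t 0) `^ a / Gamma a * scaled_integral a F t).
  apply/funext => t; have [t0|t0] := leP t 0.
    by rewrite RLint_le0E // powR0 ?gt_eqF // !mul0r.
  by rewrite RLint_scaled_ge0.
move=> t; apply: cvgM; last exact: continuous_scaled_integral.
by apply: cvgM; [exact: continuous_powR_max|exact: cvg_cst].
Qed.

Lemma max0B (y : R) : y = Num.max y 0 - Num.max (- y) 0.
Proof. by rewrite /Num.max oppr_lt0; case: ltgtP => y0; lra. Qed.

Lemma max0_decomp F : F = (fun x => Num.max (F x) 0 - Num.max (- F x) 0).
Proof. by apply/funext => x; exact: max0B. Qed.

(* Tonelli and the change of variables are available for nonnegative functions,
   so the signed case goes through the positive and negative parts. *)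
Lemma RLint_decomp a F : 0 <= a -> continuous F ->
  RLint a F = (fun t => RLint a (fun x => Num.max (F x) 0) t -
                        RLint a (fun x => Num.max (- F x) 0) t).
Proof.
move=> a0 cF; apply/funext => t; rewrite [in LHS](max0_decomp F) RLintB //.
  exact: continuous_max0.
by apply: continuous_max0 => x; apply: cvgN; exact: cF.
Qed.

Lemma continuous_RLint a F : 0 <= a -> continuous F -> continuous (RLint a F).
Proof.
rewrite le_eqVlt => /predU1P[<-|a0] cF.
  by rewrite (_ : RLint 0 F = F) //; apply/funext => x; rewrite RLint0.
rewrite (RLint_decomp a F (ltW a0) cF) => t; apply: cvgB; apply: continuous_RLint_ge0 => //.
- exact: continuous_max0.
- by move=> x; rewrite le_max lexx orbT.
- by apply: continuous_max0 => x; apply: cvgN; exact: cF.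
- by move=> x; rewrite le_max lexx orbT.
Qed.

Lemma RLint_semigroup a b F : 0 <= a -> 0 <= b -> continuous F ->
  RLint a (RLint b F) = RLint (a + b) F.
Proof.
move=> a0 b0 cF; apply/funext => t.
have [->|a'] := eqVneq a 0; first by rewrite RLint0 add0r.
have [->|b'] := eqVneq b 0.
  by rewrite addr0; congr RLint; apply/funext => x; rewrite RLint0.
have {a'}ap : 0 < a by rewrite lt_neqAle eq_sym a'.
have {b'}bp : 0 < b by rewrite lt_neqAle eq_sym b'.
have cp : continuous (fun x => Num.max (F x) 0) by exact: continuous_max0.
have cm : continuous (fun x => Num.max (- F x) 0).
  by apply: continuous_max0 => x; apply: cvgN; exact: cF.
have abp : 0 <= a + b by rewrite addr_ge0.
rewrite (RLint_decomp b F) // RLintB //; try exact: continuous_RLint.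
rewrite (RLint_decomp (a + b) F) //.
rewrite !RLint_semigroup_ge0 //; try exact: continuous_RLint.
- by move=> x; rewrite le_max lexx orbT.
- by move=> x; rewrite le_max lexx orbT.
Qed.

End riemann_liouville.

(** * Derivatives on a segment *)

Section segment_calculus.
Context {R : realType}.
Notation mu := (@lebesgue_measure R).
Implicit Types (T t : R) (f g F G : R -> R).

Lemma RLint1E t F : 0 <= t -> RLint 1 F t = \int[mu]_(x in `[0, t]) F x.
Proof.
move=> t0; rewrite /RLint oner_eq0 Gamma1 invr1 mul1r.
by apply: eq_Rintegral => x _; rewrite subrr powRr0 mul1r.
Qed.

Lemma RLint1_primitive F : continuous F ->
  exists A : R -> R, (forall x : R, 0 <= x -> is_derive x 1 A (F x)) /\
    (forall t, 0 <= t -> RLint 1 F t = A t - A 0).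
Proof.
move=> cF.
have iF a b : mu.-integrable `[a, b] (EFin \o F).
  apply: continuous_compact_integrable; first exact: segment_compact.
  exact: continuous_subspaceT.
(* Starting at -1 makes 0 an interior point, so that the primitive has a two-sided derivative there
   too. *)
exists (fun t => \int[mu]_(x in `[- 1, t]) F x); split => [x x0|t t0].
  have xu : x < x + 1 by rewrite ltrDl.
  have ax : -1 < x by apply: lt_le_trans x0; rewrite oppr_lt0.
  have [dA eA] := @continuous_FTC1_closed R F (- 1) x (x + 1) xu (iF _ _) ax (cF x).
  by apply: (DeriveDef dA); rewrite -derive1E eA.
have h1 : (BLeft (- 1) <= BRight (0 : R))%O by rewrite bnd_simp lerN10.
have h2 : (BRight (0 : R) <= BRight t)%O by rewrite bnd_simp.
rewrite (RLint1E _ _ t0) (Rintegral_itvB (iF (- 1) t) h1 h2).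
rewrite Rintegral_itv_obnd_cbnd //.
apply: (integrableS _ _ _ (iF 0 t)); [exact: measurable_itv|exact: measurable_itv|].
by move=> x /=; rewrite !in_itv /= => /andP[/ltW -> ->].
Qed.

(** Equality of the filters, rather than of limits, transfers existence and value of the derivative
    at once, including the default value of [lim]. *)
Lemma quot_dnbhs f t :
  (quot f t s @[s --> t^']) =
  ((fun h => h^-1 *: (f (h + t) - f t)) @ (0 : R)^').
Proof.
apply/funext => P; rewrite propeqE.
have := near_shift 0 t (fun s => s != t -> P (quot f t s)).
rewrite /= subr0 => E; split => [H|H].
  have {H} : \forall s \near t, s != t -> P (quot f t s) by exact: H.
  rewrite E => H.
  suff : \forall h \near (0 : R), h != 0 -> P (h^-1 *: (f (h + t) - f t)) by exact.
  apply: filterS H => h hP h0.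
  have := hP _; rewrite /quot addrK /GRing.scale /= mulrC; apply.
  by rewrite -subr_eq0 addrK.
suff : \forall s \near t, s != t -> P (quot f t s) by exact.
rewrite E.
have {H} H : \forall h \near (0 : R), h != 0 -> P (h^-1 *: (f (h + t) - f t)).
  exact: H.
apply: filterS H => h hP h0.
have := hP _; rewrite /quot addrK /GRing.scale /= mulrC; apply.
by move: h0; rewrite -subr_eq0 addrK.
Qed.

Lemma within_dnbhs_interior T t : 0 < t < T -> within `[0, T] t^' = t^'.
Proof.
move=> /andP[t0 tT]; apply/seteqP; split => P; rewrite /within /=; last first.
  by apply: filterS => s.
move=> tP.
have : \forall s \near t, `[0, T]%classic s.
  near=> s; rewrite /= in_itv /=; apply/andP; split; apply: ltW.
    by near: s; exact: lt_nbhsr.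
  by near: s; exact: lt_nbhsl.
move=> /nbhs_dnbhs tI; apply: filterS2 tP tI => s sP; exact: sP.
Unshelve. all: by end_near. Qed.

Lemma derive_seg_interior T f t : 0 < t < T -> derive_seg T f t = derive1 f t.
Proof.
by move=> tT; rewrite /derive_seg (within_dnbhs_interior _ _ tT) quot_dnbhs.
Qed.

Lemma derivable_seg_interior T f t : 0 < t < T ->
  derivable_seg T f t -> is_derive t 1 f (derive_seg T f t).
Proof.
move=> tT; rewrite (derive_seg_interior _ _ _ tT) /derivable_seg.
rewrite (within_dnbhs_interior _ _ tT) quot_dnbhs => ct.
apply: DeriveDef; last by rewrite derive1E.
rewrite /derivable.
by rewrite (_ : (fun h => _) = fun h => h^-1 *: (f (h + t) - f t)) //;
  apply/funext => h; rewrite [h%:A]mulr1.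
Qed.

Lemma is_derive_quot T f t (l : R) : is_derive t (1 : R) f l ->
  quot f t s @[s --> within `[0, T] t^'] --> l.
Proof.
move=> [df <-]; apply: (cvg_trans (cvg_app _ (cvg_within _))).
rewrite quot_dnbhs.
have E : (fun h : R => h^-1 *: (f (h + t) - f t)) =
    (fun h : R => h^-1 *: (f (h *: (1 : R) + t) - f t)).
  by apply/funext => h; rewrite [h%:A]mulr1.
by rewrite E; exact: df.
Qed.

Lemma near_interior t T : 0 < t < T -> \forall s \near t, 0 < s < T.
Proof.
move=> /andP[t0 tT]; near=> s; apply/andP; split.
  by near: s; exact: lt_nbhsr.
by near: s; exact: lt_nbhsl.
Unshelve. all: by end_near. Qed.

Lemma deriven_seg_interior T k f t : 0 < t < T ->
  deriven_seg T k f t = derive1n k f t.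
Proof.
elim: k t => [//|k IH] t tT.
rewrite /deriven_seg iterS -/(deriven_seg T k f) (derive_seg_interior _ _ _ tT).
rewrite derive1nS !derive1E; apply: near_eq_derive.
by apply: filterS (near_interior _ _ tT) => s; exact: IH.
Qed.

(** Properness gives uniqueness of one-sided limits. The witness steps to the right of [t], except
    at [T], and by at most half of the available room. *)
Lemma within_dnbhs_seg_proper T t : 0 < T -> 0 <= t <= T ->
  ProperFilter (within `[0, T] t^').
Proof.
move=> T0 /andP[t0 tT]; apply: Build_ProperFilter_ex => P.
rewrite /within /= /dnbhs /within /= => /nbhs_ballP[e /= e0 eP].
have [tT'|Tt] := ltP t T.
  pose s := t + Num.min (e / 2) ((T - t) / 2).
  have h0 : 0 < Num.min (e / 2) ((T - t) / 2).
    by rewrite lt_min !divr_gt0 // subr_gt0.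
  have h1 : Num.min (e / 2) ((T - t) / 2) <= e / 2 by rewrite ge_min lexx.
  have h2 : Num.min (e / 2) ((T - t) / 2) <= (T - t) / 2 by rewrite ge_min lexx orbT.
  exists s; apply: eP; rewrite /ball /= ?in_itv /=; rewrite /s.
  - by rewrite opprD addrA subrr sub0r normrN gtr0_norm //; lra.
  - by rewrite -subr_eq0 addrAC subrr add0r gt_eqF.
  - by apply/andP; split; lra.
pose s := t - Num.min (e / 2) (t / 2).
have h0 : 0 < Num.min (e / 2) (t / 2).
  by rewrite lt_min !divr_gt0 //; apply: lt_le_trans Tt.
have h1 : Num.min (e / 2) (t / 2) <= e / 2 by rewrite ge_min lexx.
have h2 : Num.min (e / 2) (t / 2) <= t / 2 by rewrite ge_min lexx orbT.
exists s; apply: eP; rewrite /ball /= ?in_itv /=; rewrite /s.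
- by rewrite opprB addrCA subrr addr0 gtr0_norm //; lra.
- by rewrite -subr_eq0 addrAC subrr add0r oppr_eq0 gt_eqF.
- by apply/andP; split; lra.
Qed.

Lemma eq_quot_seg T f g t : 0 <= t <= T -> (forall s, 0 <= s <= T -> f s = g s) ->
  (quot f t s @[s --> within `[0, T] t^']) =
  (quot g t s @[s --> within `[0, T] t^']).
Proof.
move=> tT fg; apply/seteqP; split => P; rewrite /fmap /= /nbhs /= /within /=;
  apply: filterS => s sP sT; have := sP sT; rewrite /quot !fg //;
  by move: sT; rewrite /= in_itv.
Qed.

(** Near [t] the difference quotient is below [|l| + 1] in absolute value, [l] being its limit, so
    [f] satisfies a Lipschitz estimate at [t]. *)
Lemma continuous_derivable_seg T f : 
  (forall t, 0 <= t <= T -> derivable_seg T f t) ->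
  {within `[0, T], continuous f}.
Proof.
move=> df; apply/subspace_continuousP => t tT.
have {}tT : 0 <= t <= T by move: tT; rewrite /= in_itv.
have := df t tT; rewrite /derivable_seg; set l := lim _ => cl.
apply/cvgrPdist_lt => e e0.
have /cvgrPdist_lt/(_ 1 ltr01) := cl; move=> cl1.
have {}cl1 : \forall s \near t, s != t -> `[0, T]%classic s -> `|l - quot f t s| < 1.
  exact: cl1.
have l0 : 0 < `|l| + 1 by rewrite ltr_wpDl.
have d0 : 0 < e / (`|l| + 1) by rewrite divr_gt0.
have : \forall s \near t, `|s - t| < e / (`|l| + 1).
  have := nbhsx_ballx t _ d0; apply: filterS => s.
  by rewrite /ball /= distrC.
move=> near_t.
have H : \forall s \near t, `[0, T]%classic s -> `|f t - f s| < e.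
  apply: filterS2 cl1 near_t => s h1 h2 sT.
  have [->|st] := eqVneq s t; first by rewrite subrr normr0.
  have {h1} h1 := h1 st sT.
  have q : `|quot f t s| < `|l| + 1.
    have := ler_distD l (quot f t s) 0; rewrite !subr0 distrC => h3.
    by apply: le_lt_trans h3 _; rewrite addrC ltrD2l.
  have -> : `|f t - f s| = `|quot f t s| * `|s - t|.
    by rewrite -normrM /quot divfK ?subr_eq0 // distrC.
  have [->|q0] := eqVneq `|quot f t s| 0; first by rewrite mul0r.
  rewrite (lt_trans (_ : _ < `|quot f t s| * (e / (`|l| + 1)))) //.
    by rewrite ltr_pM2l // lt_neqAle eq_sym q0 normr_ge0.
  by rewrite mulrCA gtr_pMr // ltr_pdivrMr // mul1r.
exact: H.
Qed.

Lemma is_derive_near_RLint1 c F f t : continuous F -> 0 < t ->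
  (\forall s \near t, f s = c + RLint 1 F s) -> is_derive t (1 : R) f (F t).
Proof.
move=> cF t0 fE; have [A [dA AE]] := RLint1_primitive F cF.
have dB : is_derive t (1 : R) (fun s => c - A 0 + A s) (F t).
  have := is_deriveD (is_derive_cst (c - A 0) t 1) (dA t (ltW t0)).
  by rewrite add0r.
apply: near_eq_is_derive dB.
have : \forall s \near t, 0 < s by exact: lt_nbhsr.
by apply: filterS2 fE => s -> s0; rewrite AE ?ltW //; lra.
Qed.

(** On the segment [f] agrees with [c - A 0 + A] for a primitive [A] that is differentiable on both
    sides of every point of [[0, T]]; the quotient within the segment sees no other values. *)
Lemma derive_seg_RLint1 T f c F : 0 < T -> continuous F ->
  (forall t, 0 <= t <= T -> f t = c + RLint 1 F t) ->
  forall t, 0 <= t <= T -> derivable_seg T f t /\ derive_seg T f t = F t.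
Proof.
move=> T0 cF fE t tT; have [A [dA AE]] := RLint1_primitive F cF.
have dB : is_derive t (1 : R) (fun s => c - A 0 + A s) (F t).
  have dAt : is_derive t (1 : R) A (F t) by apply: dA; case/andP: tT.
  by have := is_deriveD (is_derive_cst (c - A 0) t 1) dAt; rewrite add0r.
have := is_derive_quot T _ _ _ dB.
rewrite -(@eq_quot_seg T f (fun s => c - A 0 + A s) t tT); last first.
  by move=> s sT; rewrite fE // AE; [lra|case/andP: sT].
have PF := within_dnbhs_seg_proper T t T0 tT.
by move=> h; split; [exact: (cvgP _ h)|exact: cvg_lim h].
Qed.

(* D k is the k-th derivative of f; stating D k = D k 0 + I^1 (D k.+1) covers the
   one-sided derivatives at 0 and T and the two-sided ones inside at once. *)
Lemma derive_chain T N f (D : nat -> R -> R) : 0 < T ->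
  (forall t, 0 <= t <= T -> f t = D 0%N t) ->
  (forall k, (k < N)%N -> continuous (D k.+1)) ->
  (forall k, (k < N)%N -> forall t, 0 <= t <= T ->
     D k t = D k 0 + RLint 1 (D k.+1) t) ->
  [/\ forall k t, (k <= N)%N -> 0 <= t <= T -> deriven_seg T k f t = D k t,
      forall k t, (k < N)%N -> 0 <= t <= T -> derivable_seg T (deriven_seg T k f) t,
      forall k t, (k <= N)%N -> 0 < t < T -> derive1n k f t = D k t &
      forall k t, (k < N)%N -> 0 < t < T -> derivable (derive1n k f) t 1].
Proof.
move=> T0 fD cD DE.
have E k t : (k <= N)%N -> 0 <= t <= T -> deriven_seg T k f t = D k t.
  elim: k t => [|k IH] t kN tT; first exact: fD.
  rewrite /deriven_seg iterS -/(deriven_seg T k f).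
  apply: (proj2 (derive_seg_RLint1 T _ (D k 0) (D k.+1) T0 (cD k kN) _ t tT)) => s sT.
  by rewrite IH ?(ltnW kN) //; exact: DE.
have I k t : (k <= N)%N -> 0 < t < T -> derive1n k f t = D k t.
  move=> kN tT; rewrite -(@deriven_seg_interior T) //; apply: E => //.
  by case/andP: tT => /ltW -> /ltW ->.
split => // [k t kN tT|k t kN tT].
  apply: (proj1 (derive_seg_RLint1 T _ (D k 0) (D k.+1) T0 (cD k kN) _ t tT)) => s sT.
  by rewrite E ?(ltnW kN) //; exact: DE.
have t0 : 0 < t by case/andP: tT.
have H : \forall s \near t, derive1n k f s = D k 0 + RLint 1 (D k.+1) s.
  apply: filterS (near_interior _ _ tT) => s sT; rewrite I ?(ltnW kN) //.
  by apply: DE => //; case/andP: sT => /ltW -> /ltW ->.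
by have [] := is_derive_near_RLint1 _ _ _ _ (cD k kN) t0 H.
Qed.

(* Extends a function continuous on [0, T] to one continuous on R. *)
Definition clamp T f : R -> R := fun x => f (Num.min (Num.max x 0) T).

Lemma clampE T f t : 0 <= t <= T -> clamp T f t = f t.
Proof. by move=> /andP[t0 tT]; rewrite /clamp (max_idPl t0) (min_idPl tT). Qed.

Lemma clamp_in T t : 0 <= T -> 0 <= Num.min (Num.max t 0) T <= T.
Proof. by move=> T0; rewrite le_min le_max lexx orbT T0 ge_min lexx orbT. Qed.

Lemma continuous_clamp T f : 0 <= T -> {within `[0, T], continuous f} ->
  continuous (clamp T f).
Proof.
move=> T0 /subspace_continuousP cf x.
have cm : continuous (fun x : R => Num.min (Num.max x 0) T).
  move=> y; apply: (@continuous_min R R (fun x => Num.max x 0) (cst T)).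
    by apply: (@continuous_max0 R id) => z; exact: cvg_id.
  exact: cst_continuous.
have cx : Num.min (Num.max x 0) T \in `[0, T] by rewrite in_itv /= clamp_in.
apply: (cvg_trans _ (cf _ cx)).
have : (fun x : R => Num.min (Num.max x 0) T) @ x -->
    within `[0, T] (nbhs (Num.min (Num.max x 0) T)).
  move=> P; rewrite /within /= => hP.
  have : \forall y \near x, `[0, T]%classic (Num.min (Num.max y 0) T) ->
      P (Num.min (Num.max y 0) T).
    exact: (cm x _ hP).
  by apply: filterS => y; apply; rewrite /= in_itv /= clamp_in.
by move=> h P hP; apply: (h (f @^-1` P)).
Qed.

(** The difference of [u] and a primitive of [g] is continuous up to the endpoints and has zero
    derivative inside, so the mean value theorem makes it constant. *)
Lemma RLint1_of_derive T u g : continuous g ->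
  {within `[0, T], continuous u} ->
  (forall t, 0 < t < T -> is_derive t (1 : R) u (g t)) ->
  forall t, 0 <= t <= T -> u t = u 0 + RLint 1 g t.
Proof.
move=> cg cu du t /andP[t0 tT]; have [A [dA AE]] := RLint1_primitive g cg.
have sub : `[0, t]%classic `<=` `[0, T]%classic.
  by move=> x; rewrite /= !in_itv /= => /andP[-> /le_trans]; apply.
have cA : {within `[0, t], continuous A}.
  apply/subspace_continuousP => x; rewrite /= in_itv /= => /andP[x0 _].
  apply: cvg_within_filter; apply: differentiable_continuous.
  by apply/derivable1_diffP; have [] := dA x x0.
have cv : {within `[0, t], continuous (fun x => u x - A x)}.
  by apply: within_continuousB => //; exact: (continuous_subspaceW sub).
have [|c _] := @MVT_segment R (fun x => u x - A x) (fun=> 0) 0 t t0 _ cv.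
  move=> x; rewrite in_itv /= => /andP[x0 xt].
  have dux : is_derive x (1 : R) u (g x) by apply: du; rewrite x0 (lt_le_trans xt).
  have dAx := dA x (ltW x0).
  by apply: is_derive_eq; rewrite subrr.
by rewrite AE // mul0r; lra.
Qed.

Lemma continuous_sum (N : nat) (c : nat -> R) (G : nat -> R -> R) :
  (forall k, continuous (G k)) ->
  continuous (fun t => \sum_(0 <= k < N) c k * G k t).
Proof.
move=> cG; elim: N => [|N IH] t.
  by under eq_fun do rewrite big_geq //; exact: cvg_cst.
have -> : (fun t => \sum_(0 <= k < N.+1) c k * G k t) =
    (fun t => \sum_(0 <= k < N) c k * G k t + c N * G N t).
  by apply/funext => s; rewrite big_nat_recr.
by apply: cvgD; [exact: IH|apply: cvgM; [exact: cvg_cst|exact: cG]].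
Qed.

Lemma RLint_sum a (N : nat) (c : nat -> R) (G : nat -> R -> R) t : 0 <= a ->
  (forall k, continuous (G k)) ->
  RLint a (fun s => \sum_(0 <= k < N) c k * G k s) t =
  \sum_(0 <= k < N) c k * RLint a (G k) t.
Proof.
move=> a0 cG; elim: N => [|N IH].
  under eq_fun do rewrite big_geq //; rewrite big_geq //.
  have c0 : continuous (fun _ : R => 0 : R) by move=> s; exact: cvg_cst.
  by have := RLintZ a t 0 (fun=> 0) a0 c0; rewrite /= !mul0r.
under eq_fun do rewrite big_nat_recr //=; rewrite big_nat_recr //=.
rewrite RLintD //; first by rewrite IH RLintZ.
- exact: continuous_sum.
- by move=> s; apply: cvgM; [exact: cvg_cst|exact: cG].
Qed.

Lemma continuous_RLint_cst1 (a : R) : 0 <= a -> continuous (RLint a (fun=> 1 : R)).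
Proof. by move=> a0; apply: continuous_RLint => // x; exact: cvg_cst. Qed.

(** Taylor's formula with integral remainder: expand the derivative of [f] by induction, then
    integrate once with the semigroup law. *)
Lemma seg_taylor T N f : 0 < T -> Cn_seg T N f ->
  forall t, 0 <= t <= T ->
  f t = \sum_(0 <= k < N) deriven_seg T k f 0 * RLint k%:R (fun=> 1) t +
        RLint N%:R (clamp T (deriven_seg T N f)) t.
Proof.
move=> T0; elim: N f => [|N IH] f [df cf] t tT.
  by rewrite big_geq // add0r RLint0 clampE.
pose f' := derive_seg T f.
have Sf k : deriven_seg T k f' = deriven_seg T k.+1 f by rewrite /deriven_seg iterSr.
have Cf' : Cn_seg T N f'.
  split; last by rewrite Sf.
  by move=> l s lN sT; rewrite Sf; exact: df.
have f'E := IH f' Cf'; rewrite !Sf in f'E.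
set V := clamp T (deriven_seg T N.+1 f) in f'E *.
have cV : continuous V by apply: continuous_clamp => //; exact: ltW.
have cN : continuous (RLint N%:R V) by exact: continuous_RLint.
pose c k := deriven_seg T k f' 0.
have cS : continuous (fun s => \sum_(0 <= k < N) c k * RLint k%:R (fun=> 1) s).
  by apply: continuous_sum => k; exact: continuous_RLint_cst1.
pose g s := \sum_(0 <= k < N) c k * RLint k%:R (fun=> 1) s + RLint N%:R V s.
have cg : continuous g by move=> s; apply: cvgD; [exact: cS|exact: cN].
have cfT : {within `[0, T], continuous f}.
  by apply: continuous_derivable_seg => s sT; exact: (df 0%N).
have dfg s : 0 < s < T -> is_derive s (1 : R) f (g s).
  move=> sT; have sT' : 0 <= s <= T by case/andP: sT => /ltW -> /ltW ->.
  rewrite -[g s](f'E s sT'); apply: derivable_seg_interior => //.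
  exact: (df 0%N).
rewrite (RLint1_of_derive T f g cg cfT dfg t tT).
rewrite RLintD // RLint_sum //; last by move=> k; exact: continuous_RLint_cst1.
rewrite (RLint_semigroup 1 N%:R V ler01 (ler0n R N) cV) addrA.
rewrite (big_nat_recl N 0 _ (leq0n N)) RLint0 mulr1 (addrC 1 N%:R) natr1.
congr (_ + _ + _).
apply: eq_bigr => k _; rewrite /c Sf; congr (_ * _).
have c1 : continuous (fun _ : R => 1 : R) by move=> s; exact: cvg_cst.
by rewrite (RLint_semigroup 1 k%:R _ ler01 (ler0n R k) c1) addrC natr1.
Qed.

End segment_calculus.

(** * A Volterra equation *)

Section geometric_series.
Context {R : realType}.

Lemma cvg_geometric_bound (S : nat -> R) (L C : R) :
  (forall N, `|L - S N| <= C * 2^-1 ^+ N) -> S @ \oo --> L.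
Proof.
move=> SL; apply/cvgrPdist_lt => e e0.
have h : `|2^-1 : R| < 1 by rewrite ger0_norm ?invr_ge0 // invf_lt1 // ltr1n.
have /cvgrPdist_lt/(_ e e0) := cvg_geometric C h.
apply: filterS => N; rewrite sub0r normrN /= => hN.
by apply: le_lt_trans (SL N) _; apply: le_lt_trans hN; exact: ler_norm.
Qed.

Lemma geometric_bound_eq0 (x C : R) :
  (forall N, `|x| <= C * 2^-1 ^+ N) -> x = 0.
Proof.
move=> xC; have c0 : (fun _ : nat => 0 : R) @ \oo --> x.
  by apply: (@cvg_geometric_bound _ x C) => N; rewrite subr0.
have c1 : (fun _ : nat => 0 : R) @ \oo --> (0 : R) by exact: cvg_cst.
exact: (cvg_unique _ c0 c1).
Qed.

Lemma uniform_geometric_series (v : nat -> R -> R) (B : R) :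
  (forall k, continuous (v k)) ->
  (forall k x, `|v k x| <= B * 2^-1 ^+ k) ->
  exists2 G : R -> R, continuous G &
    forall N x, `|G x - \sum_(0 <= k < N) v k x| <= 2 * B * 2^-1 ^+ N.
Proof.
move=> cv vB.
have h : `|2^-1 : R| < 1 by rewrite ger0_norm ?invr_ge0 // invf_lt1 // ltr1n.
have B0 : 0 <= B.
  by have := vB 0%N 0; rewrite expr0 mulr1; apply: le_trans.
have cs x : cvgn (series (fun k => v k x)).
  apply: normed_cvg; apply: (@series_le_cvg _ _ (geometric B 2^-1)).
  - by move=> k; exact: normr_ge0.
  - by move=> k; rewrite /= mulr_ge0 ?exprn_ge0 ?invr_ge0.
  - by move=> k; exact: vB.
  - exact: is_cvg_geometric_series.
pose G x := limn (series (fun k => v k x)).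
(* The right-hand side is the exact sum of the geometric bounds from [N] to [N + p - 1]; the
   subtracted term is what lets the induction close. *)
have tail x N p : `|series (fun k => v k x) (N + p)%N - \sum_(0 <= k < N) v k x|
    <= 2 * B * 2^-1 ^+ N - 2 * B * 2^-1 ^+ (N + p)%N.
  elim: p => [|p IH]; first by rewrite addn0 /series /= !subrr normr0.
  rewrite addnS /series /= big_nat_recr //= -/(series (fun k => v k x) _).
  rewrite addrAC; apply: le_trans (ler_normD _ _) _.
  apply: le_trans (lerD IH (vB _ x)) _.
  by rewrite exprS; lra.
have GB N x : `|G x - \sum_(0 <= k < N) v k x| <= 2 * B * 2^-1 ^+ N.
  have cN : (fun p =>
      `|series (fun k => v k x) (N + p)%N - \sum_(0 <= k < N) v k x|) @ \oo
      --> `|G x - \sum_(0 <= k < N) v k x|.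
    apply: cvg_norm; apply: cvgB; last exact: cvg_cst.
    exact: (cvg_comp _ _ (cvg_addnl N) (cs x)).
  rewrite -(cvg_lim _ cN) //; apply: limr_le; first exact: (cvgP _ cN).
  apply: nearW => p; apply: le_trans (tail x N p) _.
  by rewrite lerBlDr lerDl !mulr_ge0 ?exprn_ge0 ?invr_ge0.
exists G => // x.
apply/cvgrPdist_lt => e e0.
have e3 : 0 < e / 3 by rewrite divr_gt0.
have /cvgrPdist_lt/(_ _ e3) [N _ /(_ N (leqnn N))] := cvg_geometric (2 * B) h.
rewrite sub0r normrN /= => hN.
have hN' : 2 * B * 2^-1 ^+ N < e / 3 by apply: le_lt_trans hN; exact: ler_norm.
have cSN : continuous (fun y => \sum_(0 <= k < N) v k y).
  have := @continuous_sum R N (fun=> 1) v cv.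
  by under eq_fun do under eq_bigr do rewrite mul1r.
have /cvgrPdist_lt/(_ _ e3) := cSN x; apply: filterS => y hy.
have h1 := GB N x; have h2 := GB N y.
move: h1 h2 hy; rewrite !ltr_norml !ler_norml => /andP[? ?] /andP[? ?] /andP[? ?].
by apply/andP; split; lra.
Qed.

End geometric_series.

(** * Neumann series of an operator that halves a weighted bound *)

Section volterra.
Context {R : realType}.
Variables (T l : R) (K : (R -> R) -> R -> R).
Hypothesis T0 : 0 < T.
Hypothesis l0 : 0 < l.
Hypothesis K_cont : forall g : R -> R, continuous g -> continuous (K g).
Hypothesis K_lin : forall (c : R) (g h : R -> R) (x : R), continuous g -> continuous h ->
  K (fun y => c * g y + h y) x = c * K g x + K h x.
Hypothesis K_half : forall (A : R) (g : R -> R), 0 <= A -> continuous g ->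
  (forall x, 0 <= x <= T -> `|g x| <= A * expR (l * x)) ->
  forall x, 0 <= x <= T -> `|K g x| <= A * 2^-1 * expR (l * x).

Let weight_ge1 x : 0 <= x -> 1 <= expR (l * x).
Proof.
by move=> x0; rewrite -expR0 ler_expR mulr_ge0 // ltW.
Qed.

Let bounded_weight (g : R -> R) : continuous g -> exists2 A, 0 <= A &
  forall x, 0 <= x <= T -> `|g x| <= A * expR (l * x).
Proof.
move=> cg; have [A A0 hA] := continuous_locally_bounded g T cg.
exists A => // x /andP[x0 xT]; apply: le_trans (hA x _) _.
  by rewrite ger0_norm.
by rewrite ler_peMr // weight_ge1.
Qed.

Let K_iter_bound A g k : 0 <= A -> continuous g ->
  (forall x, 0 <= x <= T -> `|g x| <= A * expR (l * x)) ->
  continuous (iter k K g) /\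
  (forall x, 0 <= x <= T -> `|iter k K g x| <= A * 2^-1 ^+ k * expR (l * x)).
Proof.
move=> A0 cg gA; elim: k => [|k [IHc IH]].
  by split => // x xT; rewrite expr0 mulr1 gA.
split; first exact: K_cont.
move=> x xT; rewrite exprSr mulrA; apply: K_half => //.
by rewrite mulr_ge0 // exprn_ge0 ?invr_ge0.
Qed.

(** Feeding the equation into itself [N] times multiplies the weighted bound by [2^-1 ^+ N]. *)
Lemma volterra_unique g : continuous g ->
  (forall x, 0 <= x <= T -> g x = - K g x) ->
  forall x, 0 <= x <= T -> g x = 0.
Proof.
move=> cg gK x xT; have [A A0 hA] := bounded_weight g cg.
apply: (@geometric_bound_eq0 R _ (A * expR (l * x))) => N.
suff H : forall x, 0 <= x <= T -> `|g x| <= A * 2^-1 ^+ N * expR (l * x).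
  by rewrite mulrAC; exact: H.
elim: N => [|N IH] y yT; first by rewrite expr0 mulr1 hA.
rewrite gK // normrN exprSr mulrA; apply: K_half => //.
by rewrite mulr_ge0 // exprn_ge0 ?invr_ge0.
Qed.

Lemma volterra_solution s : continuous s ->
  exists G, [/\ continuous G,
    forall x, 0 <= x <= T -> G x = - K G x - s x &
    exists2 C, 0 <= C & forall N x, 0 <= x <= T ->
      `|G x - \sum_(0 <= k < N) (-1) ^+ k.+1 * iter k K s x|
        <= C * 2^-1 ^+ N * expR (l * x)].
Proof.
move=> cs; have [A A0 hA] := bounded_weight s cs.
have cK k := (K_iter_bound A s k A0 cs hA).1.
have bK k := (K_iter_bound A s k A0 cs hA).2.
(* The largest value of the weighted bound on [[0, T]]; after clamping it holds on the whole line
   and yields uniform convergence to a continuous sum. *)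
pose B := A * expR (l * T).
pose u k x := (-1) ^+ k.+1 * iter k K s x.
have cu k : continuous (u k).
  by move=> y; apply: cvgM; [exact: cvg_cst|exact: cK].
pose v k := clamp T (u k).
have cvk k : continuous (v k).
  apply: continuous_clamp; first exact: ltW.
  by apply: continuous_subspaceT; exact: cu.
have vB k x : `|v k x| <= B * 2^-1 ^+ k.
  have cT := clamp_in T x (ltW T0).
  rewrite /v /clamp /u normrM normrX normrN1 expr1n mul1r.
  apply: le_trans (bK k _ cT) _.
  rewrite /B mulrAC ler_wpM2r ?exprn_ge0 ?invr_ge0 // ler_wpM2l //.
  by rewrite ler_expR ler_wpM2l ?(ltW l0) //; case/andP: cT.
have B0 : 0 <= B by rewrite mulr_ge0 ?expR_ge0.
have [G cG GB] := uniform_geometric_series v B cvk vB.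
have GS N x : 0 <= x <= T ->
    `|G x - \sum_(0 <= k < N) u k x| <= 2 * B * 2^-1 ^+ N * expR (l * x).
  move=> xT; have := GB N x.
  under eq_bigr => k _ do rewrite /v clampE //.
  move=> /le_trans; apply; rewrite ler_peMr ?mulr_ge0 ?exprn_ge0 ?invr_ge0 //.
  by apply: weight_ge1; case/andP: xT.
exists G; split => //; last by exists (2 * B); rewrite ?mulr_ge0.
pose S N x := \sum_(0 <= k < N) u k x.
have cS N : continuous (S N).
  have := @continuous_sum R N (fun=> 1) u cu.
  by under eq_fun do under eq_bigr do rewrite mul1r.
(* The partial sums satisfy the fixed-point equation up to a shift of index. The base case is
   [K 0 = 0], obtained from linearity in the form [K 0 = K 0 + K 0]. *)
have KS N x : K (S N) x = - (S N.+1 x + s x).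
  elim: N => [|N IH].
    have c0 : continuous (fun _ : R => 0 : R) by move=> y; exact: cvg_cst.
    have := K_lin 1 (fun=> 0) (fun=> 0) x c0 c0.
    rewrite (_ : (fun y : R => 1 * 0 + 0) = S 0%N); last first.
      by apply/funext => y; rewrite /S big_geq // mulr0 addr0.
    rewrite (_ : (fun=> 0) = S 0%N); last by apply/funext => y; rewrite /S big_geq.
    by rewrite [S 1%N x]/S big_nat1 /u /= expr1 mulN1r addNr oppr0; lra.
  have -> : S N.+1 = (fun y => (-1) ^+ N.+1 * iter N K s y + S N y).
    by apply/funext => y; rewrite /S big_nat_recr //= addrC.
  have -> : S N.+2 x = S N.+1 x + (-1) ^+ N.+2 * K (iter N K s) x.
    by rewrite /S big_nat_recr.
  by rewrite K_lin // IH (exprS _ N.+1); ring.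
move=> x xT; apply/eqP; rewrite -subr_eq0; apply/eqP.
(* The residual [G + K G + s] equals [K (G - S N) + (G - S N.+1)]. Each term is at most
   [B * 2^-1 ^+ N * expR (l * x)], so 4 leaves room. *)
apply: (@geometric_bound_eq0 R _ (4 * B * expR (l * x))) => N.
have cD : continuous (fun y => -1 * S N y + G y).
  by move=> y; apply: cvgD; [apply: cvgM; [exact: cvg_cst|exact: cS]|exact: cG].
have b1 : `|K (fun y => -1 * S N y + G y) x| <= 2 * B * 2^-1 ^+ N * 2^-1 * expR (l * x).
  apply: K_half => //; first by rewrite !mulr_ge0 ?exprn_ge0 ?invr_ge0.
  by move=> y yT; rewrite mulN1r addrC; exact: GS.
rewrite K_lin // KS in b1.
have b2 := GS N.+1 x xT; rewrite -/(S N.+1 x) exprS in b2.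
have -> : G x - (- K G x - s x) =
   (-1 * - (S N.+1 x + s x) + K G x) + (G x - S N.+1 x) by ring.
apply: le_trans (ler_normD _ _) _; apply: le_trans (lerD b1 b2) _.
rewrite -subr_ge0.
have -> : 4 * B * expR (l * x) * 2^-1 ^+ N -
    (2 * B * 2^-1 ^+ N * 2^-1 * expR (l * x) +
     2 * B * (2^-1 * 2^-1 ^+ N) * expR (l * x)) =
    2 * (B * expR (l * x) * 2^-1 ^+ N) by field.
by rewrite !mulr_ge0 ?expR_ge0 ?exprn_ge0 ?invr_ge0.
Qed.

End volterra.

(** * Caputo derivatives *)

Section caputo.
Context {R : realType}.
Implicit Types (T t al : R) (f F G H : R -> R).

Lemma continuous_cst1 : continuous (fun _ : R => 1 : R).
Proof. by move=> x; exact: cvg_cst. Qed.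

(** The induction goes through primitives. With [RLint_cst1] it reconciles the factorials of the
    Taylor remainder with the Gamma values in [Phi]. *)
Lemma RLint_natcst1 (j : nat) t : 0 <= t -> RLint j%:R (fun=> 1) t = t ^+ j / j`!%:R.
Proof.
elim: j t => [|j IH] t t0; first by rewrite RLint0 expr0 fact0 divr1.
have jE : RLint j.+1%:R (fun=> 1 : R) = RLint 1 (RLint j%:R (fun=> 1)).
  by rewrite (RLint_semigroup 1 j%:R _ ler01 (ler0n R j) continuous_cst1) addrC natr1.
have fne k : k`!%:R != 0 :> R by rewrite pnatr_eq0 -lt0n fact_gt0.
have cg : continuous (RLint j%:R (fun=> 1 : R)) by exact: continuous_RLint_cst1.
have du s : 0 < s < t + 1 ->
    is_derive s (1 : R) (fun x : R => x ^+ j.+1 / j.+1`!%:R) (RLint j%:R (fun=> 1) s).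
  move=> /andP[s0 _]; rewrite IH ?ltW //.
  have dX : is_derive s (1 : R) (fun x : R => x ^+ j.+1) (j.+1%:R *: s ^+ j *: 1).
    by apply: DeriveDef; [exact: exprn_derivable|exact: exp_derive].
  have -> : (fun x : R => x ^+ j.+1 / j.+1`!%:R) =
      (j.+1`!%:R)^-1 \*: (fun x : R => x ^+ j.+1).
    by apply/funext => x; rewrite /= mulrC.
  have -> : s ^+ j / j`!%:R = (j.+1`!%:R)^-1 *: (j.+1%:R *: s ^+ j *: 1).
    rewrite /GRing.scale /= factS natrM; have := fne j.
    have : j.+1%:R != 0 :> R by rewrite pnatr_eq0.
    by move: (j.+1%:R : R) (j`!%:R : R) => p q p0 q0; field; rewrite p0 q0.
  exact: is_deriveZ.
have cu : {within `[0, t + 1], continuous (fun x : R => x ^+ j.+1 / j.+1`!%:R)}.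
  apply: continuous_subspaceT => x; apply: cvgM; last exact: cvg_cst.
  exact: exprn_continuous.
have tT : 0 <= t <= t + 1 by rewrite t0 lerDl ler01.
rewrite jE; have := RLint1_of_derive (t + 1) _ _ cg cu du t tT.
by rewrite expr0n /= mul0r add0r => ->.
Qed.

Lemma taylor_rem_delta T n j f : 
  (forall k, (k < n)%N -> deriven_seg T k f 0 = (k == j)%:R) ->
  forall t, 0 <= t ->
  taylor_rem T n f t = f t - (if (j < n)%N then RLint j%:R (fun=> 1) t else 0).
Proof.
move=> df t t0; rewrite /taylor_rem; congr (_ - _).
transitivity (\sum_(0 <= k < n | k == j) (t ^+ k / k`!%:R)).
  rewrite [RHS]big_mkcond /=; apply: eq_big_nat => k /andP[_ kn].
  by rewrite df //; case: eqP => _; rewrite ?mul0r // mul1r mulrC.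
rewrite big_nat1_eq /=; case: ifP => // _.
by rewrite RLint_natcst1.
Qed.

Lemma RLint_chain_step b k F t : continuous F -> (k%:R : R) + 1 <= b ->
  RLint (b - k%:R) F t = RLint (b - k%:R) F 0 + RLint 1 (RLint (b - k.+1%:R) F) t.
Proof.
move=> cF kb.
have b0 : 0 <= b - k.+1%:R by rewrite subr_ge0 -natr1.
rewrite (RLint_semigroup 1 (b - k.+1%:R) F ler01 b0 cF).
have -> : 1 + (b - k.+1%:R) = b - k%:R by rewrite -natr1; ring.
have bk : 0 < b - k%:R by rewrite subr_gt0; apply: lt_le_trans kb; rewrite ltrDl.
by rewrite (RLint_le0E _ _ _ bk cF (lexx 0)) add0r.
Qed.

(** The semigroup law turns the integral of order [n - al] of the remainder into the [n]-fold
    integral of [H], whose [k]-th derivative is the integral of order [n - k]. *)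
Lemma caputo_of_RLint T al f H : 0 < T -> 0 < al -> al <= (ord_of al)%:R ->
  continuous H ->
  (forall t, 0 <= t <= T -> taylor_rem T (ord_of al) f t = RLint al H t) ->
  caputo_derivable T al f /\ forall t, 0 < t < T -> caputo T al f t = H t.
Proof.
set n := ord_of al => T0 al0 aln cH fE.
pose D k := RLint (n%:R - k%:R) H.
have fD t : 0 <= t <= T -> RLint (n%:R - al) (taylor_rem T n f) t = D 0%N t.
  move=> /andP[t0 tT]; rewrite (eq_RLint _ _ _ (RLint al H) t0); last first.
    by move=> x /andP[x0 xt]; rewrite fE // x0 (le_trans xt).
  have nal : 0 <= n%:R - al by rewrite subr_ge0.
  by rewrite (RLint_semigroup _ _ _ nal (ltW al0) cH) subrK /D subr0.
have Dc k : (k < n)%N -> continuous (D k.+1).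
  by move=> kn; apply: continuous_RLint => //; rewrite subr_ge0 ler_nat.
have DE k : (k < n)%N -> forall t, 0 <= t <= T -> D k t = D k 0 + RLint 1 (D k.+1) t.
  by move=> kn t _; apply: RLint_chain_step => //; rewrite natr1 ler_nat.
have [_ _ h3 h4] := derive_chain T n _ D T0 fD Dc DE.
split=> [k t kn tT|t tT]; first exact: h4.
by rewrite /caputo /RLderiv h3 // /D subrr RLint0.
Qed.

(** Integrating further by order [1 - b] gives ordinary primitives, which can be differentiated. *)
Lemma RLint_inj T b F G : 0 < T -> 0 <= b <= 1 -> continuous F -> continuous G ->
  (forall t, 0 <= t <= T -> RLint b F t = RLint b G t) ->
  forall t, 0 <= t <= T -> F t = G t.
Proof.
move=> T0 /andP[b0 b1] cF cG FG t tT.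
have b1' : 0 <= 1 - b by rewrite subr_ge0.
have E H s : continuous H -> RLint 1 H s = RLint (1 - b) (RLint b H) s.
  by move=> cH; rewrite (RLint_semigroup _ _ _ b1' b0 cH) subrK.
have FG1 s : 0 <= s <= T -> RLint 1 F s = 0 + RLint 1 G s.
  move=> /andP[s0 sT]; rewrite add0r (E F s cF) (E G s cG).
  apply: (eq_RLint _ _ _ _ s0) => x /andP[x0 xs].
  by apply: FG; rewrite x0 (le_trans xs).
have F1 s : 0 <= s <= T -> RLint 1 F s = 0 + RLint 1 F s by rewrite add0r.
have [_ <-] := derive_seg_RLint1 T _ 0 F T0 cF F1 t tT.
by have [_ <-] := derive_seg_RLint1 T _ 0 G T0 cG FG1 t tT.
Qed.

(** The converse of [caputo_of_RLint]. With [W] the N-th derivative minus its initial value, the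
    remainder is I^N W, so its integral of order [b] is I^N U for U = I^b W. Hence U' = g inside,
    and U = I^1 g = I^b I^(1-b) g. Injectivity gives W = I^(1-b) g, and N + 1 - b is [al]. *)
Lemma caputo_repr T al N j y g :
  0 < T -> N%:R < al -> al <= N.+1%:R -> ord_of al = N.+1 -> (j <= N)%N ->
  Cn_seg T N y -> (forall k, (k <= N)%N -> deriven_seg T k y 0 = (k == j)%:R) ->
  caputo_derivable T al y -> continuous g ->
  (forall t, 0 < t < T -> caputo T al y t = g t) ->
  forall t, 0 <= t <= T -> taylor_rem T N.+1 y t = RLint al g t.
Proof.
move=> T0 Nal alN aln jN Cy dy cdy cg yg.
pose V := clamp T (deriven_seg T N y).
have cV : continuous V by apply: continuous_clamp; [exact: ltW|exact: Cy.2].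
pose W x := V x - (N == j)%:R.
have cW : continuous W by move=> x; apply: cvgB; [exact: cV|exact: cvg_cst].
have O0 : 0 <= (0 : R) <= T by rewrite lexx ltW.
have W0 : W 0 = 0 by rewrite /W /V clampE // dy // subrr.
have n0 : 0 <= N%:R :> R by [].
have remE t : 0 <= t <= T -> taylor_rem T N.+1 y t = RLint N%:R W t.
  move=> tT; rewrite (@taylor_rem_delta T N.+1 j) //; last by case/andP: tT.
  rewrite ltnS jN (seg_taylor T N y T0 Cy t tT).
  rewrite (_ : \sum_(0 <= k < N) _ =
    (if (j < N)%N then RLint j%:R (fun=> 1) t else 0)); last first.
    transitivity (\sum_(0 <= k < N | k == j) RLint k%:R (fun=> 1 : R) t).
      rewrite [RHS]big_mkcond /=; apply: eq_big_nat => k /andP[_ kn].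
      by rewrite dy ?(ltnW kn) //; case: eqP => _; rewrite ?mul0r // mul1r.
    by rewrite big_nat1_eq.
  have c1 : continuous (fun _ : R => (N == j)%:R * 1 : R) by move=> x; exact: cvg_cst.
  have -> : RLint N%:R W t = RLint N%:R V t - (N == j)%:R * RLint N%:R (fun=> 1) t.
    rewrite -(RLintZ _ _ _ _ n0 continuous_cst1) -(RLintB _ _ _ _ n0 cV c1).
    by congr (RLint _ _ _); apply/funext => x; rewrite mulr1.
  move: jN; rewrite leq_eqVlt => /orP[/eqP jE|jlt].
    by rewrite jE ltnn eqxx mul1r add0r.
  by rewrite jlt gtn_eqF // mul0r subr0 addrAC subrr add0r.
pose b := N.+1%:R - al.
have b0 : 0 <= b by rewrite /b subr_ge0.
have b1 : b < 1 by rewrite /b -natr1; lra.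
pose U := RLint b W.
have cU : continuous U by exact: continuous_RLint.
(* For [b = 0] this is the initial condition of order [N]; for [b > 0] every integral of order [b]
   vanishes at 0. *)
have U0 : U 0 = 0.
  rewrite /U; have [->|bne] := eqVneq b 0; first by rewrite RLint0.
  by apply: RLint_le0E => //; rewrite lt_neqAle eq_sym bne.
pose D k := RLint (N%:R - k%:R) U.
have fD t : 0 <= t <= T -> RLint b (taylor_rem T N.+1 y) t = D 0%N t.
  move=> /andP[t0 tT]; rewrite (eq_RLint _ _ _ (RLint N%:R W) t0); last first.
    by move=> x /andP[x0 xt]; rewrite remE // x0 (le_trans xt).
  rewrite /D /U subr0 (RLint_semigroup _ _ _ b0 n0 cW) (RLint_semigroup _ _ _ n0 b0 cW).
  by rewrite addrC.
have Dc k : (k < N)%N -> continuous (D k.+1).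
  by move=> kn; apply: continuous_RLint => //; rewrite subr_ge0 ler_nat.
have DE k : (k < N)%N -> forall t, 0 <= t <= T -> D k t = D k 0 + RLint 1 (D k.+1) t.
  by move=> kn t _; apply: RLint_chain_step => //; rewrite natr1 ler_nat.
have [_ _ h3 _] := derive_chain T N _ D T0 fD Dc DE.
have dU t : 0 < t < T -> is_derive t (1 : R) U (g t).
  move=> tT; apply: (@near_eq_is_derive _ _ _
    (derive1n N (RLint b (taylor_rem T N.+1 y)))).
    apply: filterS (near_interior _ _ tT) => s sT.
    by rewrite h3 // /D subrr RLint0.
  apply: DeriveDef.
    by have := cdy N t; rewrite aln; apply.
  by rewrite -derive1E -derive1nS -(yg t tT) /caputo /RLderiv aln.
have b1' : 0 <= 1 - b by rewrite subr_ge0 ltW.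
have UE t : 0 <= t <= T -> RLint b W t = RLint b (RLint (1 - b) g) t.
  move=> tT; rewrite (RLint_semigroup _ _ _ b0 b1' cg) addrC subrK -/(U t).
  have cUT : {within `[0, T], continuous U} by exact: continuous_subspaceT.
  by rewrite (RLint1_of_derive T U g cg cUT dU t tT) U0 add0r.
have WE : forall t, 0 <= t <= T -> W t = RLint (1 - b) g t.
  apply: (@RLint_inj T b) => //; first by rewrite b0 ltW.
  exact: continuous_RLint.
move=> t tT; rewrite remE //; have /andP[t0 tT'] := tT.
rewrite (eq_RLint _ _ _ (RLint (1 - b) g) t0); last first.
  by move=> x /andP[x0 xt]; rewrite WE // x0 (le_trans xt).
rewrite (RLint_semigroup _ _ _ n0 b1' cg).
by congr (RLint _ _ _); rewrite /b -natr1; ring.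
Qed.

End caputo.

(** * The canonical system *)

Section multi_term_operator.
Context {R : realType}.
Implicit Types (T t : R) (m : nat) (al : nat -> R) (b : nat -> R -> R).

Lemma continuous_sum_nat m (F : nat -> R -> R) :
  (forall i, (1 <= i <= m)%N -> continuous (F i)) ->
  continuous (fun t => \sum_(1 <= i < m.+1) F i t).
Proof.
elim: m => [|m IH] cF t.
  by under eq_fun do rewrite big_geq //; exact: cvg_cst.
have -> : (fun t => \sum_(1 <= i < m.+2) F i t) =
    (fun t => \sum_(1 <= i < m.+1) F i t + F m.+1 t).
  by apply/funext => s; rewrite big_nat_recr.
apply: cvgD; last by apply: cF; rewrite leqnn.
by apply: IH => i /andP[i1 im]; apply: cF; rewrite i1 leqW.
Qed.

Lemma continuous_opK m al b g :
  (forall i, (1 <= i <= m)%N -> continuous (b i)) ->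
  (forall i, (1 <= i <= m)%N -> al i <= al 0%N) ->
  continuous g -> continuous (opK m al b g).
Proof.
move=> cb hal cg; apply: continuous_sum_nat => i im t.
apply: cvgM; first exact: cb.
by apply: continuous_RLint => //; rewrite subr_ge0 hal.
Qed.

Lemma opK_linear m al b (c : R) (g h : R -> R) t :
  (forall i, (1 <= i <= m)%N -> al i <= al 0%N) ->
  continuous g -> continuous h ->
  opK m al b (fun y => c * g y + h y) t = c * opK m al b g t + opK m al b h t.
Proof.
move=> hal cg ch; rewrite /opK mulr_sumr -big_split /=.
apply: eq_big_nat => i im; have a0 : 0 <= al 0%N - al i by rewrite subr_ge0 hal.
have ccg : continuous (fun y => c * g y).
  by move=> y; apply: cvgM; [exact: cvg_cst|exact: cg].
by rewrite (RLintD _ _ _ _ a0 ccg ch) (RLintZ _ _ _ _ a0 cg); ring.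
Qed.

Lemma eq_opK T m al b b' g g' t : 0 <= t <= T ->
  (forall i s, (1 <= i <= m)%N -> 0 <= s <= T -> b i s = b' i s) ->
  (forall s, 0 <= s <= T -> g s = g' s) ->
  opK m al b g t = opK m al b' g' t.
Proof.
move=> tT bb gg; apply: eq_big_nat => i im; rewrite bb //; congr (_ * _).
have /andP[t0 tT'] := tT; apply: (eq_RLint _ _ _ _ t0) => x /andP[x0 xt].
by rewrite gg // x0 (le_trans xt).
Qed.

(** Each of the [m] terms contributes at most [M * l ^ (- be)], where [be] is the smallest of the
    orders [al 0 - al i]; [l] is chosen to make the total at most 1/2. *)
Lemma opK_contraction T m al b : 0 < T ->
  (forall i, (1 <= i <= m)%N -> continuous (b i)) ->
  (forall i, (1 <= i <= m)%N -> al i <= al 1%N) -> al 1%N < al 0%N ->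
  exists2 l, 0 < l & forall (A : R) (g : R -> R), 0 <= A -> continuous g ->
  (forall x, 0 <= x <= T -> `|g x| <= A * expR (l * x)) ->
  forall x, 0 <= x <= T -> `|opK m al b g x| <= A * 2^-1 * expR (l * x).
Proof.
move=> T0 cb hal hal0.
have [M M0 hM] : exists2 M : R, 0 <= M &
    forall i x, (1 <= i <= m)%N -> 0 <= x <= T -> `|b i x| <= M.
  have /choice[Mf hMf] : forall i, exists M, 0 <= M /\
      ((1 <= i <= m)%N -> forall x, 0 <= x <= T -> `|b i x| <= M).
    move=> i; have [im|im] := boolP (1 <= i <= m)%N; last by exists 0.
    have [M M0 hM] := continuous_locally_bounded (b i) T (cb i im).
    by exists M; split=> // _ x /andP[x0 xT]; apply: hM; rewrite ger0_norm.
  exists (\sum_(1 <= i < m.+1) Mf i).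
    by apply: sumr_ge0 => i _; case: (hMf i).
  move=> i x im xT; apply: le_trans ((hMf i).2 im x xT) _.
  rewrite (big_rem i) /=; last by rewrite mem_index_iota ltnS.
  by rewrite lerDl; apply: sumr_ge0 => k _; case: (hMf k).
pose be := al 0%N - al 1%N; have be0 : 0 < be by rewrite subr_gt0.
(* [c] is to be [l ^ be]: then [m * M / c <= 1 / 2]. The summand 1 gives [l >= 1], so that a larger
   order means a smaller power [l ^ (- order)]. *)
pose c : R := 1 + 2 * m%:R * M.
have mM0 : 0 <= m%:R * M by rewrite mulr_ge0.
have c1 : 1 <= c by rewrite /c; lra.
have c0 : 0 < c by apply: lt_le_trans c1.
pose l := c `^ be^-1.
have l0 : 0 < l by rewrite powR_gt0.
have l1 : 1 <= l.
  rewrite -(powRr0 c) /l; apply: ler_powR => //.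
  by rewrite invr_ge0 ltW.
have lbe : l `^ (- be) = c^-1.
  by rewrite -powRrM mulrN mulVf ?gt_eqF // powR_inv1 // ltW.
exists l => // A g A0 cg gA x xT.
have /andP[x0 xT'] := xT.
apply: le_trans (ler_norm_sum _ _ _) _.
apply: (@le_trans _ _ (\sum_(1 <= i < m.+1) M * (A * c^-1 * expR (l * x)))).
  rewrite [leLHS]big_nat [leRHS]big_nat; apply: ler_sum => i /=; rewrite ltnS => im.
  have bi : be <= al 0%N - al i by rewrite lerB ?hal.
  have bi0 : 0 <= al 0%N - al i by apply: le_trans bi; exact: ltW.
  rewrite normrM ler_pM // ?hM //.
  have h : forall y, 0 <= y <= x -> `|g y| <= A * expR (l * y).
    by move=> y /andP[y0 yx]; apply: gA; rewrite y0 (le_trans yx).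
  apply: le_trans (RLint_expR_bound _ _ _ _ _ bi0 x0 l0 cg A0 h) _.
  rewrite ler_wpM2r ?expR_ge0 // ler_wpM2l // -lbe.
  by apply: ler_powR => //; rewrite lerN2.
rewrite big_const_nat iter_addr_0 subSS subn0 -[leLHS]mulr_natl.
have -> : m%:R * (M * (A * c^-1 * expR (l * x))) = (m%:R * M / c) * (A * expR (l * x)).
  by ring.
rewrite [leRHS]mulrAC [leRHS]mulrC; apply: ler_wpM2r.
  by rewrite mulr_ge0 ?expR_ge0.
by rewrite ler_pdivrMr // /c; lra.
Qed.

End multi_term_operator.

Section canonical_solutions.
Context {R : realType}.
Implicit Types (T t : R) (m j N : nat) (al : nat -> R) (a : nat -> R -> R).

Lemma ord_of_natP (al : R) (n : nat) : n%:R - 1 < al <= n%:R -> ord_of al = n.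
Proof.
move=> h; rewrite /ord_of (@Num.Theory.ceil_def _ _ n%:Z) //.
by rewrite intrB.
Qed.

Lemma eq_on_segment T (F G : R -> R) : 0 < T -> continuous F -> continuous G ->
  (forall t, 0 < t < T -> F t = G t) -> forall t, 0 <= t <= T -> F t = G t.
Proof.
move=> T0 cF cG FG t /andP[]; rewrite le_eqVlt => /predU1P[<-|t0].
  move=> _; have h1 : F x @[x --> 0^'+] --> F 0 by apply: cvg_at_right_filter; exact: cF.
  have h2 : F x @[x --> 0^'+] --> G 0.
    apply: (@cvg_trans _ (G x @[x --> 0^'+])); last first.
      by apply: cvg_at_right_filter; exact: cG.
    apply: near_eq_cvg; near=> x; apply/esym/FG; apply/andP; split.
      by near: x; exact: nbhs_right_gt.
    by near: x; exact: nbhs_right_lt.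
  exact: (cvg_unique _ h1 h2).
rewrite le_eqVlt => /predU1P[->|tT]; last by apply: FG; rewrite t0.
have h1 : F x @[x --> T^'-] --> F T by apply: cvg_at_left_filter; exact: cF.
have h2 : F x @[x --> T^'-] --> G T.
  apply: (@cvg_trans _ (G x @[x --> T^'-])); last first.
    by apply: cvg_at_left_filter; exact: cG.
  apply: near_eq_cvg; near=> x; apply/esym/FG; apply/andP; split.
    by near: x; exact: nbhs_left_gt.
  by near: x; exact: nbhs_left_lt.
exact: (cvg_unique _ h1 h2).
Unshelve. all: by end_near. Qed.

(** A canonical system prescribes limits of interior derivatives, the Taylor remainder uses
    one-sided derivatives at 0; continuity up to 0 identifies them. *)
Lemma deriven_seg_at0 T N z k (c : R) : 0 < T -> Cn_seg T N z -> (k <= N)%N ->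
  derive1n k z t @[t --> 0^'+] --> c -> deriven_seg T k z 0 = c.
Proof.
move=> T0 [dz cz] kN zc.
have ck : {within `[0, T], continuous (deriven_seg T k z)}.
  move: kN; rewrite leq_eqVlt => /orP[/eqP -> //|kN].
  by apply: continuous_derivable_seg => t tT; exact: dz.
have /(continuous_within_itvP _ T0)[_ h _] := ck.
have h2 : deriven_seg T k z t @[t --> 0^'+] --> c.
  apply: cvg_trans zc; apply: near_eq_cvg; near=> t.
  rewrite deriven_seg_interior //; apply/andP; split.
    by near: t; exact: nbhs_right_gt.
  by near: t; exact: nbhs_right_lt.
exact: (cvg_unique _ h h2).
Unshelve. all: by end_near. Qed.

(** Since [alpha > N], the integral term has [N] continuous derivatives that all vanish at 0, so the
    initial data are those of the monomial. *)
Lemma canonical_form T N (alpha : R) j (G : R -> R) (y : R -> R) :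
  0 < T -> N%:R < alpha -> (j <= N)%N -> continuous G ->
  (forall t, y t = RLint j%:R (fun=> 1) t + RLint alpha G t) ->
  [/\ Cn_seg T N y,
      forall k, (k <= N)%N -> deriven_seg T k y 0 = (k == j)%:R,
      forall k, (k <= N)%N -> derive1n k y t @[t --> 0^'+] --> ((k == j)%:R : R) &
      forall t, 0 <= t <= T -> taylor_rem T N.+1 y t = RLint alpha G t].
Proof.
move=> T0 Na jN cG yE.
(* The k-th derivative of [t ^ j / j!]; it is the constant 1 at [k = j] and zero afterwards. *)
pose P k (t : R) := if (k <= j)%N then RLint (j%:R - k%:R) (fun=> 1 : R) t else 0.
pose D k t := P k t + RLint (alpha - k%:R) G t.
have cP k : continuous (P k).
  rewrite /P; have [kj|kj] := leqP k j => t; last exact: cvg_cst.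
  by apply: continuous_RLint_cst1; rewrite subr_ge0 ler_nat.
have ak k : (k <= N)%N -> 0 < alpha - k%:R.
  by move=> kN; rewrite subr_gt0; apply: le_lt_trans Na; rewrite ler_nat.
have cD k : (k <= N)%N -> continuous (D k).
  move=> kN t; apply: cvgD; first exact: cP.
  by apply: continuous_RLint => //; rewrite ltW // ak.
have RL0 t : RLint 1 (fun _ : R => 0) t = 0.
  by have := RLintZ 1 t 0 _ ler01 (@continuous_cst1 R); rewrite /= !mul0r.
have PS k : (j <= k)%N -> P k.+1 = fun=> 0.
  by move=> jk; apply/funext => t; rewrite /P ltnNge jk.
have PE k t : P k t = P k 0 + RLint 1 (P k.+1) t.
  case: (ltngtP k j) => kj.
  - rewrite /P (ltnW kj) kj; apply: RLint_chain_step; first exact: continuous_cst1.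
    by rewrite natr1 ler_nat.
  - have Pk s : P k s = 0 by rewrite /P leqNgt kj.
    by rewrite (PS _ (ltnW kj)) RL0 !Pk addr0.
  - have Pk s : P k s = 1 by rewrite /P kj leqnn subrr RLint0.
    have jk : (j <= k)%N by rewrite kj.
    by rewrite (PS _ jk) RL0 !Pk addr0.
have D0 k : (k <= N)%N -> D k 0 = (k == j)%:R.
  move=> kN; rewrite /D (RLint_le0E _ _ _ (ak k kN) cG (lexx 0)) addr0 /P.
  case: (ltngtP k j) => kj //; last by rewrite kj subrr RLint0.
  by rewrite RLint_le0E ?subr_gt0 ?ltr_nat //; exact: continuous_cst1.
have yD t : 0 <= t <= T -> y t = D 0%N t by move=> _; rewrite yE /D /P leq0n !subr0.
have DE k : (k < N)%N -> forall t, 0 <= t <= T -> D k t = D k 0 + RLint 1 (D k.+1) t.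
  move=> kN t _.
  have aS : continuous (RLint (alpha - k.+1%:R) G).
    by apply: continuous_RLint => //; rewrite ltW // ak.
  rewrite (RLintD _ _ _ _ ler01 (cP k.+1) aS).
  rewrite {1}/D PE (RLint_chain_step _ k G t cG); first by rewrite /D; ring.
  by rewrite natr1 -subr_ge0 ltW // ak.
have [h1 h2 h3 _] := derive_chain T N y D T0 yD (fun k kN => cD k.+1 kN) DE.
have O0 : 0 <= (0 : R) <= T by rewrite lexx ltW.
have dy0 k : (k <= N)%N -> deriven_seg T k y 0 = (k == j)%:R.
  by move=> kN; rewrite h1 // D0.
split=> //.
- split; first by move=> k t kN tT; exact: h2.
  apply: (subspace_eq_continuous (f := D N)).
    by move=> t; rewrite inE /= in_itv /= => tT; rewrite /from_subspace /= h1.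
  by apply: continuous_subspaceT; exact: cD.
- move=> k kN; rewrite -(D0 k kN).
  apply: (@cvg_trans _ (D k t @[t --> 0^'+])); last first.
    by apply: cvg_at_right_filter; exact: cD.
  apply: near_eq_cvg; near=> t; rewrite h3 //; apply/andP; split.
    by near: t; exact: nbhs_right_gt.
  by near: t; exact: nbhs_right_lt.
- move=> t /andP[t0 tT]; rewrite (@taylor_rem_delta _ T N.+1 j) //.
  by rewrite ltnS jN yE addrAC subrr add0r.
Unshelve. all: by end_near. Qed.

End canonical_solutions.

(** * Reduction of the differential equation to the Volterra equation *)

Section equation.
Context {R : realType}.
Implicit Types (T t : R) (m j N p : nat) (al : nat -> R) (a b : nat -> R -> R).

(** The Taylor polynomial of order [p] removes the monomial exactly when [j < p]. What is left is
    the integral of order [be] of the claimed derivative, and [caputo_of_RLint] applies. *)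
Lemma lower_caputo T N p (alpha be : R) j (y G : R -> R) :
  0 < T -> continuous G ->
  (forall t, 0 <= t <= T -> y t = RLint j%:R (fun=> 1) t + RLint alpha G t) ->
  (forall k, (k <= N)%N -> deriven_seg T k y 0 = (k == j)%:R) ->
  (p <= N)%N -> p%:R - 1 < be <= p%:R -> 0 < be -> be <= alpha ->
  caputo_derivable T be y /\
  forall t, 0 < t < T -> caputo T be y t =
    (if (p <= j)%N then RLint (j%:R - be) (fun=> 1) t else 0) +
    RLint (alpha - be) G t.
Proof.
move=> T0 cG yE dy pN pP be0 beal.
have aG : 0 <= alpha - be by rewrite subr_ge0.
have cI : continuous (RLint (alpha - be) G) by exact: continuous_RLint.
pose Q t := if (p <= j)%N then RLint (j%:R - be) (fun=> 1 : R) t else 0.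
have jbe : (p <= j)%N -> 0 <= j%:R - be.
  move=> pj; rewrite subr_ge0; case/andP: pP => _ /le_trans; apply.
  by rewrite ler_nat.
have cQ : continuous Q.
  rewrite /Q; have [pj|pj] := leqP p j => t; last exact: cvg_cst.
  by apply: continuous_RLint_cst1; exact: jbe.
have be0' := ltW be0.
have [_ bep] := andP pP.
apply: (@caputo_of_RLint _ T be y (fun t => Q t + RLint (alpha - be) G t)) => //.
- by rewrite (@ord_of_natP _ _ p).
- by move=> t; apply: cvgD; [exact: cQ|exact: cI].
rewrite (@ord_of_natP _ _ p) // => t tT; have /andP[t0 _] := tT.
rewrite (@taylor_rem_delta _ T p j) //; last first.
  by move=> k kp; apply: dy; apply: leq_trans pN; exact: ltnW.
rewrite (RLintD _ _ _ _ be0' cQ cI) (RLint_semigroup _ _ _ be0' aG cG).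
rewrite yE // (addrC be) subrK.
have -> : RLint be Q t = if (p <= j)%N then RLint j%:R (fun=> 1) t else 0.
  rewrite /Q; have [pj|pj] := leqP p j.
    by rewrite (RLint_semigroup _ _ _ be0' (jbe pj) (@continuous_cst1 R)) addrC subrK.
  by have := RLintZ be t 0 _ be0' (@continuous_cst1 R); rewrite /= !mul0r.
rewrite [(j < p)%N]ltnNge; case: (p <= j)%N => /=; first by rewrite subr0.
by rewrite addrAC subrr !add0r.
Qed.

(* n i is the ceiling of al i, so n i <= j means al i <= j; otherwise the Caputo
   derivative of order al i kills t^j. *)
Definition lower_source m al (n : nat -> nat) a j (t : R) : R :=
  \sum_(1 <= i < m.+1) a i t *
    (if (n i <= j)%N then RLint (j%:R - al i) (fun=> 1) t else 0).

Lemma eq_lower_source T m al n a b j t : 0 <= t <= T ->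
  (forall i s, (1 <= i <= m)%N -> 0 <= s <= T -> a i s = b i s) ->
  lower_source m al n a j t = lower_source m al n b j t.
Proof. by move=> tT ab; apply: eq_big_nat => i im; rewrite ab. Qed.

Lemma continuous_lower_source m al n b j :
  (forall i, (1 <= i <= m)%N -> continuous (b i)) ->
  (forall i, (1 <= i <= m)%N -> al i <= (n i)%:R) ->
  continuous (lower_source m al n b j).
Proof.
move=> cb aln; apply: continuous_sum_nat => i im t; apply: cvgM; first exact: cb.
have [pj|pj] := leqP (n i) j; last exact: cvg_cst.
apply: continuous_RLint_cst1; rewrite subr_ge0 (le_trans (aln i im)) //.
by rewrite ler_nat.
Qed.

Lemma source_lower_source m al n a j h t : 0 <= t -> (1 <= h)%N ->
  (forall i, (1 <= i <= m)%N -> (h <= i)%N = (n i <= j)%N) ->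
  (forall i, (1 <= i <= m)%N -> al i <= (n i)%:R) ->
  source m al a j h t = lower_source m al n a j t.
Proof.
move=> t0 h1 hn aln; rewrite /source /lower_source.
rewrite (big_nat_widenl _ 1) // [LHS]big_mkcond /=.
rewrite [LHS]big_nat [RHS]big_nat; apply: eq_bigr => i im; rewrite ltnS in im.
rewrite hn //; case: ifP => [nj|_]; last by rewrite mulr0.
have aj : 0 <= j%:R - al i.
  by rewrite subr_ge0 (le_trans (aln i im)) // ler_nat.
by rewrite (RLint_cst1 _ _ aj t0); congr (_ * Phi _ _); rewrite -natr1; ring.
Qed.

(** Stated for any [y] with the given initial data and remainder, so that it serves both the
    constructed system and an arbitrary competitor. *)
Lemma canonical_solution_equation T N m al (n : nat -> nat) a j (y G : R -> R) :
  0 < T -> (j <= N)%N -> continuous G -> N%:R < al 0%N <= N.+1%:R ->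
  (forall i, (1 <= i <= m)%N -> [/\ (n i)%:R - 1 < al i <= (n i)%:R,
     (n i <= N)%N, 0 < al i & al i <= al 0%N]) ->
  (forall k, (k <= N)%N -> deriven_seg T k y 0 = (k == j)%:R) ->
  (forall t, 0 <= t <= T -> taylor_rem T N.+1 y t = RLint (al 0%N) G t) ->
  [/\ forall i, (i <= m)%N -> caputo_derivable T (al i) y,
      forall t, 0 < t < T -> caputo T (al 0%N) y t = G t &
      forall t, 0 < t < T -> \sum_(1 <= i < m.+1) a i t * caputo T (al i) y t =
        opK m al a G t + lower_source m al n a j t].
Proof.
move=> T0 jN cG a0P aP dy ry.
have yE t : 0 <= t <= T -> y t = RLint j%:R (fun=> 1) t + RLint (al 0%N) G t.
  move=> tT; rewrite -ry // (@taylor_rem_delta _ T N.+1 j) //; last by case/andP: tT.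
  by rewrite ltnS jN addrC subrK.
have low i : (1 <= i <= m)%N -> _ := fun im =>
  let: And4 h1 h2 h3 h4 := aP i im in
  lower_caputo T N (n i) (al 0%N) (al i) j y G T0 cG yE dy h2 h1 h3 h4.
have o0 : ord_of (al 0%N) = N.+1.
  by apply: ord_of_natP; rewrite -natr1 addrK natr1.
have [a0N a0N'] := andP a0P.
have a00 : 0 < al 0%N by apply: le_lt_trans a0N.
have [c0 e0] : caputo_derivable T (al 0%N) y /\
    forall t, 0 < t < T -> caputo T (al 0%N) y t = G t.
  by apply: caputo_of_RLint => //; rewrite o0.
split=> //.
- by case=> [//|i] im; apply: (low i.+1 _).1; rewrite im.
- move=> t tT; rewrite /opK /lower_source -big_split /=.
  by apply: eq_big_nat => i im; rewrite (low i im).2 // mulrDr addrC.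
Qed.

(** Integration of order [al 0] preserves the weighted geometric error bound up to a constant, so
    the integrated partial sums converge to the integral of [G]. *)
Lemma series_formula_of_solution T m al a b h (C l : R) j (s G y : R -> R) :
  0 < T -> 0 < l -> 0 < al 0%N -> 0 <= C ->
  (forall i, (1 <= i <= m)%N -> continuous (b i)) ->
  (forall i, (1 <= i <= m)%N -> al i <= al 0%N) ->
  (forall i t, (1 <= i <= m)%N -> 0 <= t <= T -> a i t = b i t) ->
  continuous s -> continuous G ->
  (forall t, 0 <= t <= T -> source m al a j h t = s t) ->
  (forall N x, 0 <= x <= T ->
     `|G x - \sum_(0 <= k < N) (-1) ^+ k.+1 * iter k (opK m al b) s x|
        <= C * 2^-1 ^+ N * expR (l * x)) ->
  (forall t, 0 <= t <= T -> y t = RLint j%:R (fun=> 1) t + RLint (al 0%N) G t) ->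
  series_formula T m al a j h y.
Proof.
move=> T0 l0 a0 C0 cb hal ab cs cG sE GS yE t tT; have /andP[t0 tT'] := tT.
have a0' := ltW a0.
have it k x : 0 <= x <= T -> iter k (opK m al a) (source m al a j h) x =
    iter k (opK m al b) s x.
  elim: k x => [|k IH] x xT; first exact: sE.
  by rewrite !iterS; apply: (eq_opK T).
have cit k : continuous (iter k (opK m al b) s).
  by elim: k => [//|k IH]; rewrite iterS; apply: continuous_opK.
have cv : series (series_term m al a j h t) @ \oo --> RLint (al 0%N) G t.
  apply: (@cvg_geometric_bound R _ _ (C * l `^ (- al 0%N) * expR (l * t))) => N.
  pose S x := \sum_(0 <= k < N) (-1) ^+ k.+1 * iter k (opK m al b) s x.
  have cS : continuous S by exact: continuous_sum.
  have -> : series (series_term m al a j h t) N = RLint (al 0%N) S t.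
    rewrite (RLint_sum _ _ _ _ _ a0' cit); apply: eq_bigr => k _.
    rewrite /series_term; congr (_ * _); apply: (eq_RLint _ _ _ _ t0) => x /andP[x0 xt].
    by apply: it; rewrite x0 (le_trans xt).
  rewrite -(RLintB _ _ _ _ a0' cG cS).
  have cGS : continuous (fun x => G x - S x).
    by move=> x; apply: cvgB; [exact: cG|exact: cS].
  have CN : 0 <= C * 2^-1 ^+ N by rewrite mulr_ge0 ?exprn_ge0 ?invr_ge0.
  have GSt x : 0 <= x <= t -> `|G x - S x| <= C * 2^-1 ^+ N * expR (l * x).
    by move=> /andP[x0 xt]; apply: GS; rewrite x0 (le_trans xt).
  have := RLint_expR_bound _ _ _ _ _ a0' t0 l0 cGS CN GSt.
  by move/le_trans; apply; rewrite le_eqVlt; apply/orP; left; apply/eqP; ring.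
split; first exact: (cvgP _ cv).
rewrite (cvg_lim _ cv) // yE //; congr (_ + _).
by rewrite (RLint_cst1 _ _ (ler0n R j) t0) natr1.
Qed.

End equation.

Theorem theorem4 (R : realType) (T : R) (m : nat) (al : nat -> R)
    (n : nat -> nat) (a : nat -> R -> R) (j0 : nat) (h : nat -> nat)
    (T_gt0 : 0 < T) (m_ge1 : (1 <= m)%N)
    (al_decr : forall i : nat, (i < m)%N -> al i.+1 < al i)
    (al_ge0 : 0 <= al m)
    (nP : forall i : nat, (i <= m)%N -> (n i)%:R - 1 < al i <= (n i)%:R)
    (n10 : (n 1%N < n 0%N)%N)
    (a_cont : forall i : nat, (1 <= i <= m)%N ->
       {within `[0, T], continuous (a i)})
    (n0_ge2 : (2 <= n 0%N)%N)
    (j0_le : (j0 <= n 0%N - 2)%N)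
    (H_j0 : Hset m al j0 = set0)
    (H_j0S : Hset m al j0.+1 !=set0)
    (hP : forall j : nat, (j0.+1 <= j)%N -> is_min (Hset m al j) (h j)) :
  exists y : nat -> R -> R,
    [/\ canonical_system T m al a (n 0%N) y /\
        (forall j : nat, (j < n 0%N)%N -> Cfrac T (al 0%N) (n 0%N).-1 (y j)),
        (forall z : nat -> R -> R,
           canonical_system T m al a (n 0%N) z ->
           (forall j : nat, (j < n 0%N)%N ->
              Cfrac T (al 0%N) (n 0%N).-1 (z j)) ->
           forall (j : nat) (t : R), (j < n 0%N)%N -> 0 <= t <= T ->
             z j t = y j t),
        (forall (j : nat) (t : R), (j <= j0)%N -> 0 <= t <= T ->
           y j t = Phi j.+1%:R t),
        (forall j : nat, (j0.+1 <= j)%N -> (j < n 1%N)%N ->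
           series_formula T m al a j (h j) (y j)) &
        (forall j : nat, (n 1%N <= j)%N -> (j < n 0%N)%N ->
           series_formula T m al a j 1%N (y j))].
Proof.
have al_anti i k : (i < k)%N -> (k <= m)%N -> al k < al i.
  elim: k => [//|k IH]; rewrite ltnS leq_eqVlt => /orP[/eqP -> km|ik km].
    exact: al_decr.
  by apply: lt_trans (IH ik (ltnW km)); exact: al_decr.
have al_lt0 i : (1 <= i <= m)%N -> al i < al 0%N.
  by move=> /andP[i1 im]; exact: al_anti.
have al_le1 i : (1 <= i <= m)%N -> al i <= al 1%N.
  move=> /andP[i1 im]; move: i1; rewrite leq_eqVlt => /orP[/eqP <- //|i1].
  by apply/ltW/al_anti.
(* All the orders are nonnegative, so an order at most [j0] would put its index into the empty
   set. *)
have al_j0 i : (1 <= i <= m)%N -> j0%:R < al i.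
  move=> im; rewrite ltNge; apply/negP => aj.
  have : Hset m al j0 i; last by rewrite H_j0.
  split=> //; rewrite aj andbT (le_trans al_ge0) //.
  case/andP: im => _; rewrite leq_eqVlt => /orP[/eqP -> //|im].
  by apply/ltW/al_anti.
have al_gt0 i : (1 <= i <= m)%N -> 0 < al i.
  by move=> im; apply: le_lt_trans (al_j0 i im).
have n_le i j : (i <= m)%N -> (n i <= j)%N = (al i <= j%:R).
  move=> im; have /andP[h1 h2] := nP i im; apply/idP/idP => h3.
    by apply: le_trans h2 _; rewrite ler_nat.
  rewrite -ltnS -(ltr_nat R) -natr1.
  by move: h1; rewrite ltrBlDr => /lt_le_trans; apply; rewrite lerD2r.
pose N := (n 0%N).-1.
have n0N : n 0%N = N.+1 by rewrite /N prednK // (leq_trans _ n0_ge2).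
have a0P : N%:R < al 0%N <= N.+1%:R.
  by have := nP 0%N (leq0n m); rewrite n0N -natr1 addrK.
have [a0N a0N'] := andP a0P.
have a00 : 0 < al 0%N by apply: le_lt_trans a0N.
have al_n i : (1 <= i <= m)%N -> al i <= (n i)%:R.
  by move=> /andP[_ im]; case/andP: (nP i im).
have aP i : (1 <= i <= m)%N -> [/\ (n i)%:R - 1 < al i <= (n i)%:R,
     (n i <= N)%N, 0 < al i & al i <= al 0%N].
  move=> im; have /andP[i1 im'] := im; split.
  - exact: nP.
  - rewrite n_le // (le_trans (al_le1 i im)) // -n_le //.
    by rewrite -ltnS -n0N.
  - exact: al_gt0.
  - by apply/ltW/al_lt0.
have al_le0 i : (1 <= i <= m)%N -> al i <= al 0%N by move=> im; case: (aP i im).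
pose b i := if (1 <= i <= m)%N then clamp T (a i) else fun=> 0.
have cb i : (1 <= i <= m)%N -> continuous (b i).
  by move=> im; rewrite /b im; apply: continuous_clamp; [exact: ltW|exact: a_cont].
have ab i t : (1 <= i <= m)%N -> 0 <= t <= T -> a i t = b i t.
  by move=> im tT; rewrite /b im clampE.
pose K := opK m al b.
pose s := lower_source m al n b.
have cs j : continuous (s j) by exact: continuous_lower_source.
have al10 : al 1%N < al 0%N by apply: al_lt0; rewrite leqnn.
have [l l0 Khalf] := opK_contraction T m al b T_gt0 cb al_le1 al10.
have Kcont g : continuous g -> continuous (K g) by exact: continuous_opK.
have Klin (c : R) (g h' : R -> R) x : continuous g -> continuous h' ->
    K (fun y => c * g y + h' y) x = c * K g x + K h' x.
  by move=> cg ch; exact: opK_linear.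
have uniq := volterra_unique T l K l0 Khalf.
have /choice[G hG] j := volterra_solution T l K T_gt0 l0 Kcont Klin Khalf (s j) (cs j).
have cG j : continuous (G j) by case: (hG j).
have GE j x : 0 <= x <= T -> G j x = - K (G j) x - s j x by case: (hG j) => _ + _; apply.
(* The source cancels in the difference of two solutions, which therefore solves the homogeneous
   equation. *)
have G_unique j g : continuous g ->
    (forall x, 0 <= x <= T -> g x = - K g x - s j x) ->
    forall x, 0 <= x <= T -> g x = G j x.
  move=> cg gE x xT.
  have cd : continuous (fun y => -1 * G j y + g y).
    by move=> y; apply: cvgD; [apply: cvgM; [exact: cvg_cst|exact: cG]|exact: cg].
  have dE y : 0 <= y <= T -> -1 * G j y + g y = - K (fun y => -1 * G j y + g y) y.
    by move=> yT; rewrite Klin // {1}(GE j y yT) {1}(gE y yT); ring.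
  by have := uniq _ cd dE x xT; lra.
pose y j t := RLint j%:R (fun=> 1) t + RLint (al 0%N) (G j) t.
have form j : (j <= N)%N -> _ := fun jN =>
  canonical_form T N (al 0%N) j (G j) (y j) T_gt0 a0N jN (cG j) (fun=> erefl).
have sE j t : 0 <= t <= T -> lower_source m al n a j t = s j t.
  by move=> tT; apply: eq_lower_source tT _ => i x im xT; exact: ab.
have KE g t : 0 <= t <= T -> opK m al a g t = K g t.
  by move=> tT; apply: (eq_opK T).
have ysol j : (j <= N)%N -> [/\ forall i, (i <= m)%N -> caputo_derivable T (al i) (y j),
      forall t, 0 < t < T -> caputo T (al 0%N) (y j) t = G j t &
      forall t, 0 < t < T -> \sum_(1 <= i < m.+1) a i t * caputo T (al i) (y j) t =
        opK m al a (G j) t + lower_source m al n a j t].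
  move=> jN; have [_ dy _ ry] := form j jN.
  exact: canonical_solution_equation T_gt0 jN (cG j) a0P aP dy ry.
have seriesE j h' : (j <= N)%N -> (1 <= h')%N ->
    (forall i, (1 <= i <= m)%N -> (h' <= i)%N = (n i <= j)%N) ->
    series_formula T m al a j h' (y j).
  move=> jN h1 hn; have [_ _ [C C0 hC]] := hG j.
  apply: (series_formula_of_solution T m al a b h' C l j (s j) (G j)) => //.
  move=> t tT; rewrite (source_lower_source m al n) // ?sE //.
  by case/andP: tT.
exists y; split.
- split=> j; rewrite n0N ltnS => jN; have [Cy dy ly ry] := form j jN;
    have [cy c0 ceq] := ysol j jN.
  + split; last by move=> k kN; exact: ly.
    split=> // t tT; rewrite c0 // ceq //.
    have tT' : 0 <= t <= T by case/andP: tT => /ltW -> /ltW ->.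
    by rewrite KE // sE // GE //; ring.
  + split => //; first exact: cy.
    exists (G j); split; last exact: c0.
    exact: continuous_subspaceT.
- move=> z zcan zC j t jn0 tT; have jN : (j <= N)%N by rewrite -ltnS -n0N.
  have [[zcd zeq] zlim] := zcan j jn0.
  have [Cz cz0 [g0 [cg0 g0E]]] := zC j jn0.
  have dz k : (k <= N)%N -> deriven_seg T k (z j) 0 = (k == j)%:R.
    move=> kN; apply: (deriven_seg_at0 T N) => //.
    by apply: zlim; rewrite n0N ltnS.
  pose g := clamp T g0.
  have cg : continuous g by apply: continuous_clamp => //; exact: ltW.
  have gE x : 0 < x < T -> caputo T (al 0%N) (z j) x = g x.
    by move=> xT; rewrite g0E // /g clampE //; case/andP: xT => /ltW -> /ltW ->.
  have o0 : ord_of (al 0%N) = N.+1.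
    by apply: ord_of_natP; rewrite -natr1 addrK natr1.
  have rz := caputo_repr T (al 0%N) N j (z j) g T_gt0 a0N a0N' o0 jN Cz dz cz0 cg gE.
  have [_ _ ceq] :=
    canonical_solution_equation T N m al n a j (z j) g T_gt0 jN cg a0P aP dz rz.
  (* The differential equation gives this on []0, T[] only; both sides are continuous, hence the
     endpoints. *)
  have gK : forall x, 0 <= x <= T -> g x = - K g x - s j x.
    apply: (eq_on_segment T) => //.
      move=> x; apply: cvgB; last exact: cs.
      by apply: cvgN; exact: Kcont.
    move=> x xT; have xT' : 0 <= x <= T by case/andP: xT => /ltW -> /ltW ->.
    by rewrite -gE // zeq // ceq // KE // sE //; ring.
  have gG := G_unique j g cg gK.
  have /andP[t0 tT'] := tT.
  have := rz t tT; rewrite (@taylor_rem_delta _ T N.+1 j) // ltnS jN => rzt.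
  rewrite /y -(eq_RLint _ _ g (G j) t0); first by rewrite -rzt addrC subrK.
  by move=> x /andP[x0 xt]; rewrite gG // x0 (le_trans xt).
- move=> j t jj0 tT; have /andP[t0 tT'] := tT.
  (* For [j <= j0 < al i] every lower Caputo derivative kills [t ^ j]; with zero source [G j] is
     zero and only the monomial remains. *)
  have s0 x : s j x = 0.
    apply: big1_seq => i /=; rewrite mem_index_iota ltnS => im.
    rewrite n_le; last by case/andP: im.
    rewrite leNgt (le_lt_trans _ (al_j0 i im)) ?ler_nat //=; exact: mulr0.
  have G0 x : 0 <= x <= T -> G j x = 0.
    by apply: uniq => // u uT; rewrite {1}GE // s0 subr0.
  have I0 : RLint (al 0%N) (G j) t = 0.
    rewrite (eq_RLint _ _ _ (fun=> 0) t0); last first.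
      by move=> x /andP[x0 xt]; rewrite G0 // x0 (le_trans xt).
    by have := RLintZ (al 0%N) t 0 _ (ltW a00) (@continuous_cst1 R); rewrite /= !mul0r.
  by rewrite /y I0 addr0 (RLint_cst1 _ _ (ler0n R j) t0) natr1.
- move=> j j0j jn1; have [[h1 h2] hmin] := hP j j0j; have [h1' h2'] := andP h1.
  apply: seriesE => //.
    by rewrite -ltnS -n0N; apply: ltn_trans n10.
  (* As the orders decrease, every index from the minimum [h j] on also belongs to the set, which is
     therefore a tail. *)
  move=> i im; have [i1 im'] := andP im.
  rewrite n_le //; apply/idP/idP => [hi|aj].
    have [_ ahj] := andP h2; apply: le_trans ahj.
    move: hi; rewrite leq_eqVlt => /orP[/eqP -> //|hi].
    by apply/ltW/al_anti.
  by apply: hmin; split=> //; rewrite aj ltW // al_gt0.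
- move=> j n1j jn0; apply: seriesE => //.
    by rewrite -ltnS -n0N.
  (* Here [al i <= al 1 <= n 1 <= j], so the tail is the whole range. *)
  move=> i im; have [i1 im'] := andP im.
  rewrite i1; apply/esym; rewrite n_le // (le_trans (al_le1 i im)) //.
  by rewrite -n_le.
Qed.
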